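(* For the Doi--Onsager interaction $W_{\mathrm{DO}}(\theta)=-|\sin(2\pi\theta)|$ on $\mathbb T$, the free energy $\mathcal F_K$ undergoes a continuous phase transition at $$K_c=K_\#=\frac{3\pi}{4}.$$
   Context: $\mathbb T=[-\frac12,\frac12)$ with periodic boundary conditions; $\mathcal P(\mathbb T)$ denotes Borel probability measures, identified with densities when absolutely continuous; $q_u\equiv1$ is the uniform distribution. Fourier coefficients: $\widehat f(k)=\int_{\mathbb T}f(\theta)e^{-2\pi ik\theta}d\theta$. Free energy: for $K\ge0$, $\mathcal F_K(q)=\int_{\mathbb T}\log q\,dq-K\iint W(\theta-\theta')\,dq(\theta)dq(\theta')$ ($+\infty$ if $q$ is not absolutely continuous). A number $K_c\ge0$ is the critical coupling if for $K<K_c$, $q_u$ is the unique global minimizer of $\mathcal F_K$; at $K=K_c$, $q_u$ is a global minimizer; for $K>K_c$ there is a global minimizer $q\ne q_u$. The phase transition is continuous if at $K=K_c$ the global minimizer is unique and for every family $\{q_K:K>K_c\}$ of global minimizers, $\limsup_{K\to K_c^+}\|q_K-q_u\|_{L^1}=0$; otherwise discontinuous. The linear stability threshold is $K_\#=\big(2\max_{k\ge1,\widehat W(k)>0}\widehat W(k)\big)^{-1}$. Here $W_{\mathrm{DO}}(\theta)=-\frac2\pi+\frac4\pi\sum_{\ell\ge1}\frac{\cos(4\pi\ell\theta)}{4\ell^2-1}$. *)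

(* Defs.v *)
From HB Require Import structures.
From mathcomp Require Import all_boot all_order all_algebra.
From mathcomp Require Import all_classical all_reals all_analysis.
Set Implicit Arguments. Unset Strict Implicit. Unset Printing Implicit Defensive.
Import Order.TTheory GRing.Theory Num.Theory.
Import numFieldNormedType.Exports.
Local Open Scope classical_set_scope.
Local Open Scope ring_scope.

Section DoiOnsager.
Variable R : realType.

Notation mu := (@lebesgue_measure R).

(* The torus T = [-1/2, 1/2) (periodicity is built into W via sin). *)
Definition Tor : set R := `[(- (2^-1)), (2^-1)[%classic.

Definition W_DO (th : R) : R := - `|sin (2 * pi * th)|.

Definition is_density (q : R -> R) : Prop :=
  measurable_fun Tor q /\ (forall x, Tor x -> 0 <= q x) /\
  (\int[mu]_(x in Tor) (q x)%:E = 1)%E.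

Definition q_u : R -> R := fun _ => 1.

(* Equality of densities (equality as measures) = a.e. equality on T. *)
Definition dens_eq (q p : R -> R) : Prop :=
  {ae mu, forall x, Tor x -> q x = p x}.

Definition entropy (q : R -> R) : \bar R :=
  (\int[mu]_(x in Tor) (q x * ln (q x))%:E)%E.

Definition interaction (W : R -> R) (q : R -> R) : \bar R :=
  (\int[mu]_(x in Tor) \int[mu]_(y in Tor) (W (x - y) * q x * q y)%:E)%E.

Definition free_energy (W : R -> R) (K : R) (q : R -> R) : \bar R :=
  (entropy q - K%:E * interaction W q)%E.

Definition is_global_minimizer (W : R -> R) (K : R) (q : R -> R) : Prop :=
  is_density q /\
  forall p, is_density p -> (free_energy W K q <= free_energy W K p)%E.

Definition is_critical_coupling (W : R -> R) (Kc : R) : Prop :=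
  0 <= Kc /\
  (forall K, 0 <= K -> K < Kc ->
     is_global_minimizer W K q_u /\
     forall q, is_global_minimizer W K q -> dens_eq q q_u) /\
  is_global_minimizer W Kc q_u /\
  (forall K, Kc < K -> exists q, is_global_minimizer W K q /\ ~ dens_eq q q_u).

Definition L1_dist_u (q : R -> R) : \bar R :=
  (\int[mu]_(x in Tor) (`|q x - 1|)%:E)%E.

Definition continuous_transition (W : R -> R) (Kc : R) : Prop :=
  (forall q1 q2, is_global_minimizer W Kc q1 -> is_global_minimizer W Kc q2 ->
     dens_eq q1 q2) /\
  (forall qK : R -> R -> R,
     (forall K, Kc < K -> is_global_minimizer W K (qK K)) ->
     (fun K => L1_dist_u (qK K)) @ Kc^'+ --> 0%E).

Definition fourier_re (W : R -> R) (k : nat) : R :=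
  Rintegral mu Tor (fun x => W x * cos (2 * pi * k%:R * x)).
Definition fourier_im (W : R -> R) (k : nat) : R :=
  - Rintegral mu Tor (fun x => W x * sin (2 * pi * k%:R * x)).

Definition fourier_pos (W : R -> R) (k : nat) : Prop :=
  fourier_im W k = 0 /\ 0 < fourier_re W k.

Definition is_linear_threshold (W : R -> R) (Ks : R) : Prop :=
  exists k0 : nat, (1 <= k0)%N /\ fourier_pos W k0 /\
    (forall k : nat, (1 <= k)%N -> fourier_pos W k ->
        fourier_re W k <= fourier_re W k0) /\
    Ks = (2 * fourier_re W k0)^-1.

End DoiOnsager.

(* Main.v *)
(* The kernel expands as |sin t| = 2/pi - (4/pi) sum_l cos(2 l t)/(4 l^2 - 1),
   so with c_l the coefficient of a density q at frequency 2 l,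
     F_K(q) - F_K(q_u) = Ent(q) - (K / K_c) sum_l 3 |c_l|^2 / (4 l^2 - 1),   K_c = 3 pi / 4.
   The Lebedev-Milin inequality log int e^(2 Re G) <= sum_k k |g_k|^2 dualises to the
   logarithmic Hardy-Littlewood-Sobolev inequality Ent(q) >= sum_l |c_l|^2 / l. Since
   3 / (4 l^2 - 1) <= 1 / l with equality only at l = 1, this settles K <= K_c up to the
   first mode. Keeping the deficit |g_2 - g_1^2 / 2|^2 in Lebedev-Milin ties c_1^2 to c_2
   and gives |c_1|^4 <= C (Ent(q) - (K_c-energy)), hence uniqueness at K_c and, by a
   Pinsker-type inequality, convergence of minimizers as K decreases to K_c. For K > K_c
   the density 1 + e cos(4 pi x) beats q_u, and a minimizer exists by the direct method:
   the energy is a convex functional minus a positive semidefinite quadratic form, so a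
   minimizing sequence can be replaced by Gibbs states of its potentials, which are
   equi-Lipschitz. *)
Require Import Defs.
From HB Require Import structures.
From mathcomp Require Import all_boot all_order all_algebra.
From mathcomp Require Import all_classical all_reals all_analysis.
From mathcomp Require Import measurable_realfun ring lra.
Import Order.TTheory GRing.Theory Num.Theory.
Import numFieldNormedType.Exports.
Set Implicit Arguments. Unset Strict Implicit. Unset Printing Implicit Defensive.
Local Open Scope classical_set_scope.
Local Open Scope ring_scope.

(** * Fourier expansion of the absolute value of sine *)

(** Densities are only known to have finite entropy, so no [L^2] Fourier theory applies to them. The
    cosine series of [|sin|] is therefore cut off with an explicit uniform error of order [1 / N];
    statements about the energy are first proved up to that error, and [kern_tol_lim] removes it. At
    [3 pi / 4] the quadratic energy and the logarithmic HLS bound agree exactly at [l = 1], so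
    second order says nothing about [c_1] there. Control comes from fourth order: [|c_2 - c_1^2|^2],
    the Lebedev-Milin deficit up to a factor, cannot be small together with [|c_2|^2] unless [c_1]
    is small, and [|c_2|^2] is itself charged because [1 / l] is at least [5 / 2] times
    [3 / (4 l^2 - 1)] for [l >= 2]. In the direct method only the potentials are passed to a limit,
    where the convergence is uniform; the densities are not. *)

Section pointwise_derivatives.
Variable R : realType.
Implicit Types (f g : R -> R) (x df dg : R).

Lemma is_derive_addf f g x df dg : is_derive x 1 f df -> is_derive x 1 g dg ->
  is_derive x 1 (fun t => f t + g t) (df + dg).
Proof. exact: is_deriveD. Qed.

Lemma is_derive_oppf f x df : is_derive x 1 f df ->
  is_derive x 1 (fun t => - f t) (- df).
Proof. exact: is_deriveN. Qed.

Lemma is_derive_mulf f g x df dg : is_derive x 1 f df -> is_derive x 1 g dg ->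
  is_derive x 1 (fun t => f t * g t) (f x * dg + g x * df).
Proof. exact: is_deriveM. Qed.

Lemma is_derive_constf (c x : R) : is_derive x 1 (fun _ => c) 0.
Proof. exact: is_derive_cst. Qed.

Lemma is_derive_idf x : is_derive x 1 (fun t : R => t) 1.
Proof. exact: is_derive_id. Qed.

Lemma is_derive_compf f g x df dg : is_derive (g x) 1 f df ->
  is_derive x 1 g dg -> is_derive x 1 (fun t => f (g t)) (dg * df).
Proof.
by move=> Hf Hg; rewrite mulrC; exact: is_derive1_comp.
Qed.

Lemma is_derive_cosf g x dg : is_derive x 1 g dg ->
  is_derive x 1 (fun t => cos (g t)) (dg * - sin (g x)).
Proof. exact: is_derive_compf. Qed.

Lemma is_derive_sinf g x dg : is_derive x 1 g dg ->
  is_derive x 1 (fun t => sin (g t)) (dg * cos (g x)).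
Proof. exact: is_derive_compf. Qed.

Lemma is_derive_expf g x dg : is_derive x 1 g dg ->
  is_derive x 1 (fun t => expR (g t)) (dg * expR (g x)).
Proof. exact: is_derive_compf. Qed.

Lemma is_derive_sumf N (h : nat -> R -> R) (dh : nat -> R) x :
  (forall i, is_derive x 1 (h i) (dh i)) ->
  is_derive x 1 (fun t => \sum_(i < N) h i t) (\sum_(i < N) dh i).
Proof.
move=> H; have := @is_derive_sum _ _ _ N (fun i => h i) x 1 (fun i => dh i) (fun i => H i).
by congr is_derive; apply/funext => t; rewrite fct_sumE.
Qed.

Lemma is_derive_divf f g x df dg : is_derive x 1 f df -> is_derive x 1 g dg ->
  g x != 0 ->
  is_derive x 1 (fun t => f t / g t) ((df * g x - f x * dg) / g x ^+ 2).
Proof.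
move=> Hf Hg g0; have Hi := is_deriveV g0 Hg.
have := is_derive_mulf Hf Hi.
move/is_derive_eq; apply; rewrite /GRing.scale /=; field => //.
Qed.

Lemma is_derive_continuous f x df : is_derive x 1 f df -> {for x, continuous f}.
Proof. by move=> [Hf _]; apply/differentiable_continuous/derivable1_diffP. Qed.

Lemma mvt_deriv f (df : R -> R) (a b : R) : a < b ->
  (forall t, t \in `[a, b] -> is_derive t 1 f (df t)) ->
  exists2 c, a < c < b & f b - f a = df c * (b - a).
Proof.
move=> ab H.
have H1 t : t \in `]a, b[ -> is_derive t 1 f (df t).
  by move=> tab; apply: H; exact: subset_itv_oo_cc tab.
have H2 : {within `[a, b], continuous f}.
  by apply: derivable_within_continuous => t /H[].
have [c cab E] := MVT ab H1 H2.
by exists c; [move: cab; rewrite in_itv|exact: E].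
Qed.

End pointwise_derivatives.

Ltac deriv_step :=
  match goal with
  | |- is_derive _ _ (fun _ => ?c) _ => notypeclasses refine (is_derive_constf _ _)
  | |- is_derive _ _ (fun t => t) _ => notypeclasses refine (is_derive_idf _)
  | |- is_derive _ _ (GRing.mul ?c) _ =>
      notypeclasses refine (is_derive_mulf (is_derive_constf c _) (is_derive_idf _))
  | |- is_derive _ _ cos _ => notypeclasses refine (is_derive_cos _)
  | |- is_derive _ _ sin _ => notypeclasses refine (is_derive_sin _)
  | |- is_derive _ _ (fun t => @?f t + @?g t) _ =>
      notypeclasses refine (is_derive_addf _ _)
  | |- is_derive _ _ (fun t => - @?f t) _ => notypeclasses refine (is_derive_oppf _)
  | |- is_derive _ _ (fun t => @?f t * @?g t) _ =>
      notypeclasses refine (is_derive_mulf _ _)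
  | |- is_derive _ _ (fun t => cos (@?f t)) _ => notypeclasses refine (is_derive_cosf _)
  | |- is_derive _ _ (fun t => sin (@?f t)) _ => notypeclasses refine (is_derive_sinf _)
  | |- is_derive _ _ (fun t => expR (@?f t)) _ => notypeclasses refine (is_derive_expf _)
  end.
Ltac deriv := notypeclasses refine (is_derive_eq _ _); [repeat deriv_step|cbv beta].

Section sine_expansion.
Variable R : realType.
Implicit Types (x t : R) (N i : nat).

(** Index [i] stands for the mode [l = i + 1], so the first weight is [1 / 3]. *)
Definition sine_weight i : R := (4 * i.+1%:R ^+ 2 - 1)^-1.

Definition sine_sum N x : R :=
  \sum_(i < N) sine_weight i * cos (2 * i.+1%:R * x).

Lemma sine_weight_factor i :
  sine_weight i = (2 * i%:R + 1)^-1 * (2 * i.+1%:R + 1)^-1.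
Proof.
rewrite /sine_weight -invfM; congr (_ ^-1); rewrite -(natr1 i); ring.
Qed.

Lemma odd_nat_neq0 i : (2 * i%:R + 1 : R) != 0.
Proof. by rewrite gt_eqF// ltr_wpDl// mulr_ge0. Qed.

Lemma sine_weight_gt0 i : 0 < sine_weight i.
Proof. by rewrite sine_weight_factor mulr_gt0// invr_gt0 ltr_wpDl// mulr_ge0. Qed.

Definition sine_sum' N x : R :=
  \sum_(i < N) sine_weight i * (2 * i.+1%:R * - sin (2 * i.+1%:R * x)).

Lemma is_derive_sine_sum N x : is_derive x 1 (sine_sum N) (sine_sum' N x).
Proof.
apply: (@is_derive_sumf R N (fun i t => sine_weight i * cos (2 * i.+1%:R * t))
  (fun i => sine_weight i * (2 * i.+1%:R * - sin (2 * i.+1%:R * x)))) => i.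
by deriv; ring.
Qed.

(* The Wronskian of the partial sum with [sin] telescopes. *)
Lemma sine_sum_wronskian N x :
  sine_sum' N x * sin x - sine_sum N x * cos x =
  - (cos x - cos ((2 * N%:R + 1) * x) / (2 * N%:R + 1)) / 2.
Proof.
elim: N => [|N IH].
  by rewrite /sine_sum' /sine_sum !big_ord0 mulr0 add0r mul1r divr1 subrr !mul0r
    subrr oppr0 mul0r.
rewrite /sine_sum' /sine_sum !big_ord_recr /= -/(sine_sum' N x) -/(sine_sum N x).
set A := sine_sum' N x in IH *; set B := sine_sum N x in IH *.
have -> : (A + sine_weight N * (2 * N.+1%:R * - sin (2 * N.+1%:R * x))) * sin x -
  (B + sine_weight N * cos (2 * N.+1%:R * x)) * cos x =
  (A * sin x - B * cos x) - sine_weight N *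
   (2 * N.+1%:R * sin (2 * N.+1%:R * x) * sin x + cos (2 * N.+1%:R * x) * cos x).
  by ring.
rewrite {}IH sine_weight_factor.
have -> : (2 * N%:R + 1) * x = 2 * N.+1%:R * x - x by rewrite -(natr1 N); ring.
have -> : (2 * N.+1%:R + 1) * x = 2 * N.+1%:R * x + x by ring.
rewrite cosB cosD.
have := odd_nat_neq0 N; have := odd_nat_neq0 N.+1.
rewrite -(natr1 N); set c := cos (_ * x); set s := sin (_ * x).
by move=> h1 h2; field; rewrite h1 h2.
Qed.

(* The Sturm comparison with [sin]: if the Wronskian is nonpositive then
   [f / sin] decreases. *)
Lemma wronskian_comparison (f df : R -> R) x :
  (forall t, is_derive t 1 f (df t)) ->
  (forall t, df t * sin t - f t * cos t <= 0) ->
  0 < x < pi / 2 -> f (pi / 2) * sin x <= f x.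
Proof.
move=> Hf Hw /andP[x0 xpi].
have sin0 t : x <= t <= pi / 2 -> 0 < sin t.
  move=> /andP[xt tpi]; apply: sin_gt0_pi; rewrite (lt_le_trans x0 xt)/=.
  by rewrite (le_lt_trans tpi)//; have := pi_gt0 R; lra.
have [c|c /andP[xc cpi]] := @mvt_deriv R (fun t => f t / sin t)
  (fun t => (df t * sin t - f t * cos t) / sin t ^+ 2) _ _ xpi.
  rewrite in_itv /= => /sin0 s0.
  by apply: is_derive_divf => //; rewrite gt_eqF.
rewrite sin_pihalf divr1 => E.
have : f (pi / 2) - f x / sin x <= 0.
  rewrite E; apply: mulr_le0_ge0; last by rewrite subr_ge0 ltW.
  by apply: mulr_le0_ge0 => //; rewrite invr_ge0 sqr_ge0.
by rewrite subr_le0 ler_pdivlMr// sin0// lexx ltW.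
Qed.

(** On [[0, pi]] this is [pi / 4] times the error of the truncated expansion of [sin]. *)
Definition sine_err N x : R := sine_sum N x - 2^-1 + pi / 4 * sin x.
Definition sine_err' N x : R := sine_sum' N x + pi / 4 * cos x.

Lemma is_derive_sine_err N x : is_derive x 1 (sine_err N) (sine_err' N x).
Proof.
rewrite /sine_err; deriv; first exact: is_derive_sine_sum.
by rewrite /sine_err'; ring.
Qed.

(** The tail [sum_(l > N) 1 / (4 l^2 - 1)], which telescopes; it is also the amplitude of the
    Wronskian of the error. *)
Definition sine_tol N : R := (2 * (2 * N%:R + 1))^-1.

Lemma sine_tol_ge0 N : 0 <= sine_tol N.
Proof. by rewrite invr_ge0 !mulr_ge0// addr_ge0// mulr_ge0. Qed.

Lemma sine_err_wronskian N x : sine_err' N x * sin x - sine_err N x * cos x =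
  sine_tol N * cos ((2 * N%:R + 1) * x).
Proof.
have := sine_sum_wronskian N x; rewrite /sine_err /sine_err' /sine_tol.
set A := sine_sum' N x; set B := sine_sum N x => H.
transitivity ((A * sin x - B * cos x) + cos x / 2); first by field.
by rewrite H; have := odd_nat_neq0 N => h; field; rewrite h.
Qed.

(** The Wronskian of [cos] with [sin] is [-1], so adding [sine_tol N * cos] to the error or to its
    opposite absorbs the oscillating term of [sine_err_wronskian] and gives it a sign. What stays
    undetermined is the multiple of [sin], that is, the value at [pi / 2]. *)
Lemma sine_err_bounds N x : 0 < x < pi / 2 ->
  sine_err N (pi / 2) * sin x - sine_tol N * cos x <= sine_err N x /\
  sine_err N x <= sine_err N (pi / 2) * sin x + sine_tol N * cos x.
Proof.
move=> xpi; have t0 := sine_tol_ge0 N; split.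
  have := @wronskian_comparison (fun t => sine_err N t + sine_tol N * cos t)
    (fun t => sine_err' N t - sine_tol N * sin t) x.
  rewrite cos_pihalf mulr0 addr0 => H.
  rewrite lerBlDr; apply: H => // t.
    by deriv; [exact: is_derive_sine_err|ring].
  have -> : (sine_err' N t - sine_tol N * sin t) * sin t -
    (sine_err N t + sine_tol N * cos t) * cos t =
    (sine_err' N t * sin t - sine_err N t * cos t) -
    sine_tol N * (cos t ^+ 2 + sin t ^+ 2) by ring.
  by rewrite sine_err_wronskian cos2Dsin2 -mulrBr; apply: mulr_ge0_le0.
have := @wronskian_comparison (fun t => - sine_err N t + sine_tol N * cos t)
    (fun t => - sine_err' N t - sine_tol N * sin t) x.
rewrite cos_pihalf mulr0 addr0 => H.
suff : - sine_err N (pi / 2) * sin x <= - sine_err N x + sine_tol N * cos x by lra.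
apply: H => // t.
  by deriv; [exact: is_derive_sine_err|ring].
have -> : (- sine_err' N t - sine_tol N * sin t) * sin t -
  (- sine_err N t + sine_tol N * cos t) * cos t =
  - (sine_err' N t * sin t - sine_err N t * cos t) -
  sine_tol N * (cos t ^+ 2 + sin t ^+ 2) by ring.
rewrite sine_err_wronskian cos2Dsin2 -mulrN -mulrBr mulr_ge0_le0//.
Qed.

Lemma sin_natpi n : sin (n%:R * pi) = 0 :> R.
Proof.
elim: n => [|n IH]; first by rewrite mul0r sin0.
by rewrite -natr1 mulrDl mul1r sinDpi IH oppr0.
Qed.

Definition sine_prim N x : R :=
  \sum_(i < N) sine_weight i * (sin (2 * i.+1%:R * x) / (2 * i.+1%:R))
  - x / 2 - pi / 4 * cos x.

Lemma is_derive_sine_prim N x : is_derive x 1 (sine_prim N) (sine_err N x).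
Proof.
rewrite /sine_prim /sine_err; notypeclasses refine (is_derive_eq _ _).
  notypeclasses refine (is_derive_addf _ _); last by repeat deriv_step.
  notypeclasses refine (is_derive_addf _ _); last by repeat deriv_step.
  apply: (@is_derive_sumf R N (fun i t => sine_weight i * (sin (2 * i.+1%:R * t) / (2 * i.+1%:R)))
  (fun i => sine_weight i * cos (2 * i.+1%:R * x))) => i.
  deriv; have h : (i.+1%:R : R) != 0 by rewrite pnatr_eq0.
  by field.
by rewrite /sine_sum; field.
Qed.

(* The antiderivative takes the same value at [0] and at [pi / 2]. *)
Lemma sine_err_pihalf N : `|sine_err N (pi / 2)| <= sine_tol N.
Proof.
have pi2 : 0 < pi / 2 :> R by have := pi_gt0 R; lra.
have P0 : sine_prim N 0 = - (pi / 4).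
  rewrite /sine_prim big1 ?mul0r ?subr0 ?cos0 ?mulr1 ?sub0r// => i _.
  by rewrite mulr0 sin0 mul0r mulr0.
have P1 : sine_prim N (pi / 2) = - (pi / 4).
  rewrite /sine_prim big1 ?cos_pihalf; first lra.
  move=> i _; rewrite (_ : 2 * _ * _ = i.+1%:R * pi); last by field.
  by rewrite sin_natpi mul0r mulr0.
set e := sine_err N (pi / 2); set a := sine_tol N.
rewrite ler_norml; apply/andP; split.
  (* By the upper bound this function has a nonpositive derivative. Its end values are [e - pi / 4]
     and [- a - pi / 4], hence [- a <= e]. The other half is symmetric. *)
  have [c _|c cpi] := @mvt_deriv R
    (fun t => sine_prim N t + e * cos t - a * sin t)
    (fun t => sine_err N t - e * sin t - a * cos t) _ _ pi2.
    by deriv; [exact: is_derive_sine_prim|ring].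
  have [_] := sine_err_bounds N cpi; rewrite -/e -/a P0 P1.
  rewrite cos0 sin0 cos_pihalf sin_pihalf => h E.
  suff : (sine_err N c - e * sin c - a * cos c) * (pi / 2 - 0) <= 0 by lra.
  by apply: mulr_le0_ge0; lra.
have [c _|c cpi] := @mvt_deriv R
    (fun t => sine_prim N t + e * cos t + a * sin t)
    (fun t => sine_err N t - e * sin t + a * cos t) _ _ pi2.
  by deriv; [exact: is_derive_sine_prim|ring].
have [+ _] := sine_err_bounds N cpi; rewrite -/e -/a P0 P1.
rewrite cos0 sin0 cos_pihalf sin_pihalf => h E.
suff : 0 <= (sine_err N c - e * sin c + a * cos c) * (pi / 2 - 0) by lra.
by apply: mulr_ge0; lra.
Qed.

Lemma sine_sum0 N : sine_sum N 0 = 2^-1 - sine_tol N.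
Proof.
have := sine_sum_wronskian N 0; rewrite sin0 !mulr0 cos0 sub0r mulr1 => H.
rewrite -[LHS]opprK H /sine_tol; have := odd_nat_neq0 N => h; field; by rewrite h.
Qed.

Lemma sine_err_quarter N x : 0 <= x <= pi / 2 ->
  `|sine_err N x| <= 2 * sine_tol N.
Proof.
have a0 := sine_tol_ge0 N.
rewrite le_eqVlt => /andP[/predU1P[<- _|x0]].
  rewrite /sine_err sine_sum0 sin0 mulr0 addr0 addrAC subrr sub0r normrN.
  by rewrite ger0_norm//; lra.
have := sine_err_pihalf N; set e := sine_err N (pi / 2) => he.
rewrite le_eqVlt => /predU1P[->|xpi]; first by rewrite (le_trans he)//; lra.
have [] := @sine_err_bounds N x; first by rewrite x0.
rewrite -/e => h1 h2.
have c0 : 0 <= cos x by apply: cos_ge0_pihalf; have := pi_gt0 R; lra.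
have s0 : 0 <= sin x by apply: sin_ge0_pi; have := pi_gt0 R; lra.
have c1 := cos_le1 x; have s1 := sin_le1 x.
have : sine_tol N * cos x <= sine_tol N by apply: ler_piMr.
have : `|e * sin x| <= sine_tol N.
  by rewrite normrM (ger0_norm s0) (le_trans _ he)// ler_piMr.
rewrite ler_norml => /andP[h3 h4] h5.
by rewrite ler_norml; apply/andP; split; lra.
Qed.

Lemma sine_err_half N x : 0 <= x <= pi -> `|sine_err N x| <= 2 * sine_tol N.
Proof.
move=> /andP[x0 xpi]; have [xl|xl] := lerP x (pi / 2).
  by apply: sine_err_quarter; rewrite x0.
suff -> : sine_err N x = sine_err N (pi - x) by apply: sine_err_quarter; lra.
rewrite /sine_err; congr (_ - _ + _ * _).
  apply: eq_bigr => i _; congr (_ * _).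
  rewrite -cosN (_ : - _ = 2 * i.+1%:R * (pi - x) - pi *+ 2 *+ i.+1).
    by rewrite -[in LHS](@periodicn _ _ _ _ (@cosD2pi R) i.+1) subrK.
  by rewrite -mulrnA -[pi *+ _]mulr_natr natrM; ring.
by rewrite -[in RHS]opprB sinN sinB sinpi cospi; ring.
Qed.

(** The range contains [2 pi (x - y)] for all [x], [y] in [Tor]. Evenness and [pi]-periodicity of
    both sides reduce it to [[0, pi]]. *)
Lemma sine_expansion N x : - (2 * pi) <= x <= 2 * pi ->
  `| `|sin x| - (2 / pi - 4 / pi * sine_sum N x)| <= 4 / pi * (2 * sine_tol N).
Proof.
have p0 := pi_gt0 R; have pn0 : pi != 0 :> R by rewrite gt_eqF.
have half (y : R) : 0 <= y <= pi ->
  `| `|sin y| - (2 / pi - 4 / pi * sine_sum N y)| <= 4 / pi * (2 * sine_tol N).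
  move=> ypi; rewrite [ `|sin y|]ger0_norm; last by apply: sin_ge0_pi.
  have -> : sin y - (2 / pi - 4 / pi * sine_sum N y) = 4 / pi * sine_err N y.
    by rewrite /sine_err; move: pi pn0 => q q0; field.
  rewrite normrM ger0_norm; last by rewrite divr_ge0// ltW.
  by rewrite ler_wpM2l// ?divr_ge0 ?(ltW p0)//; exact: sine_err_half.
have full (y : R) : 0 <= y <= 2 * pi ->
  `| `|sin y| - (2 / pi - 4 / pi * sine_sum N y)| <= 4 / pi * (2 * sine_tol N).
  move=> /andP[y0 y2]; have [yl|yl] := lerP y pi; first by apply: half; rewrite y0.
  have -> : sin y = - sin (y - pi) by rewrite -sinDpi subrK.
  have -> : sine_sum N y = sine_sum N (y - pi).
    apply: eq_bigr => i _; congr (_ * _).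
    rewrite (_ : 2 * i.+1%:R * y = 2 * i.+1%:R * (y - pi) + pi *+ 2 *+ i.+1).
      by rewrite (periodicn (@cosD2pi R)).
    by rewrite -mulrnA -[pi *+ _]mulr_natr natrM; ring.
  by rewrite normrN; apply: half; lra.
move=> /andP[xl xu]; have [x0|x0] := lerP 0 x; first by apply: full; rewrite x0.
have := full (- x); rewrite sinN normrN.
have -> : sine_sum N (- x) = sine_sum N x.
  by apply: eq_bigr => i _; rewrite mulrN cosN.
by apply; lra.
Qed.

End sine_expansion.

(** * Coefficients of the exponential of a trigonometric polynomial *)

Section exponential_coefficients.
Variable R : realType.
Implicit Types (g d a b c H A : nat -> R) (M N n : nat).

(** Course-of-values recursion through the list of earlier values; [x0] fills the positions beyond
    the list, which [F n] cannot see by hypothesis. *)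
Lemma strong_recursion (T : Type) (x0 : T) (F : nat -> (nat -> T) -> T) :
  (forall n f h, (forall i, (i < n)%N -> f i = h i) -> F n f = F n h) ->
  exists f, forall n, f n = F n f.
Proof.
move=> HF; pose fix s n := if n is m.+1 then rcons (s m) (F m (nth x0 (s m))) else [::].
have sz n : size (s n) = n by elim: n => //= n IH; rewrite size_rcons IH.
have sE n i : (i < n)%N -> nth x0 (s n) i = nth x0 (s i.+1) i.
  elim: n => // n IH; rewrite ltnS leq_eqVlt => /predU1P[->//|lin].
  by rewrite [LHS]/= nth_rcons sz lin IH.
exists (fun n => nth x0 (s n.+1) n) => n.
rewrite [LHS]/= nth_rcons sz ltnn eqxx; apply: HF => i; exact: sE.
Qed.

(* Coefficients [a + i b] of [exp (sum_k (g k + i d k) z^k)], characterised by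
   the recurrence that comes from differentiating in [z]. *)
Definition exp_rec g d a b : Prop :=
  [/\ a 0%N = 1, b 0%N = 0,
   forall n, n.+1%:R * a n.+1 =
     \sum_(i < n.+1) i.+1%:R * (g i.+1 * a (n - i)%N - d i.+1 * b (n - i)%N) &
   forall n, n.+1%:R * b n.+1 =
     \sum_(i < n.+1) i.+1%:R * (g i.+1 * b (n - i)%N + d i.+1 * a (n - i)%N)].

Lemma exp_rec_exists g d : exists a b, exp_rec g d a b.
Proof.
pose F n (f : nat -> R * R) : R * R := if n is m.+1 then
  (m.+1%:R^-1 * \sum_(i < m.+1)
     i.+1%:R * (g i.+1 * (f (m - i)%N).1 - d i.+1 * (f (m - i)%N).2),
   m.+1%:R^-1 * \sum_(i < m.+1)
     i.+1%:R * (g i.+1 * (f (m - i)%N).2 + d i.+1 * (f (m - i)%N).1)) else (1, 0).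
have [|f Hf] := @strong_recursion _ (0, 0) F.
  move=> [//|n] f h fh /=; congr (_ * _, _ * _); apply: eq_bigr => i _;
  by rewrite fh// ltnS leq_subr.
exists (fun n => (f n).1), (fun n => (f n).2); split.
- by rewrite Hf.
- by rewrite Hf.
- by move=> n; rewrite (Hf n.+1) mulVKf// pnatr_eq0.
- by move=> n; rewrite (Hf n.+1) mulVKf// pnatr_eq0.
Qed.

(** Real exponents get their own construction so that the imaginary coefficients are literally
    [fun=> 0], the form in which the majorant is stated. *)
Lemma exp_rec_real A : exists H, exp_rec A (fun=> 0) H (fun=> 0).
Proof.
pose F n (f : nat -> R) : R := if n is m.+1 then
  m.+1%:R^-1 * \sum_(i < m.+1) i.+1%:R * (A i.+1 * f (m - i)%N) else 1.
have [|f Hf] := @strong_recursion _ 0 F.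
  move=> [//|n] f h fh /=; congr (_ * _); apply: eq_bigr => i _;
  by rewrite fh// ltnS leq_subr.
exists f; split.
- by rewrite Hf.
- by [].
- move=> n; rewrite (Hf n.+1) /= mulVKf ?pnatr_eq0//.
  by apply: eq_bigr => i _; rewrite mul0r subr0.
- by move=> n; rewrite mulr0 big1// => i _; rewrite mulr0 mul0r addr0 mulr0.
Qed.

Lemma exp_rec_real_ge0 A H : (forall k, 0 <= A k) ->
  exp_rec A (fun=> 0) H (fun=> 0) -> forall n, 0 <= H n.
Proof.
move=> A0 [H0 _ HH _]; elim/ltn_ind => -[_|n IH]; first by rewrite H0.
rewrite -(pmulr_rge0 _ (ltr0Sn R n)) HH sumr_ge0// => i _.
by rewrite mul0r subr0 !mulr_ge0// IH// ltnS leq_subr.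
Qed.

(** This is the substitution of [e^(i x) z] for [z]; it carries estimates at [z = 1] to every point
    of the unit circle. *)
Lemma exp_rec_rotate g d a b (x : R) : exp_rec g d a b ->
  exp_rec (fun k => g k * cos (k%:R * x) - d k * sin (k%:R * x))
          (fun k => g k * sin (k%:R * x) + d k * cos (k%:R * x))
          (fun k => a k * cos (k%:R * x) - b k * sin (k%:R * x))
          (fun k => a k * sin (k%:R * x) + b k * cos (k%:R * x)).
Proof.
have angle n (i : 'I_n.+1) : n.+1%:R * x = i.+1%:R * x + (n - i)%N%:R * x :> R.
  by rewrite -mulrDl -natrD addSn subnKC// -ltnS.
move=> [a0 b0 Ha Hb]; split.
- by rewrite a0 b0 mul0r cos0 sin0; ring.
- by rewrite a0 b0 mul0r cos0 sin0; ring.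
- move=> n; transitivity ((n.+1%:R * a n.+1) * cos (n.+1%:R * x)
    - (n.+1%:R * b n.+1) * sin (n.+1%:R * x)); first by ring.
  rewrite Ha Hb !mulr_suml -sumrB; apply: eq_bigr => i _.
  by rewrite (angle n i) cosD sinD; ring.
- move=> n; transitivity ((n.+1%:R * a n.+1) * sin (n.+1%:R * x)
    + (n.+1%:R * b n.+1) * cos (n.+1%:R * x)); first by ring.
  rewrite Ha Hb !mulr_suml -big_split; apply: eq_bigr => i _ /=.
  by rewrite (angle n i) cosD sinD; ring.
Qed.

Lemma sqr_sum_le n (x : 'I_n -> R) :
  (\sum_i x i) ^+ 2 <= n%:R * \sum_i x i ^+ 2.
Proof.
elim: n x => [|n IH] x; first by rewrite !big_ord0 expr0n mulr0.
rewrite !big_ord_recr /=; set y := x ord_max.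
set S := \sum_(i < n) _; set Q := \sum_(i < n) _ ^+ 2.
have h1 : S ^+ 2 <= n%:R * Q by exact: IH.
have h2 : 2 * S * y <= Q + n%:R * y ^+ 2.
  have -> : Q + n%:R * y ^+ 2 =
      \sum_(i < n) (x (widen_ord (leqnSn n) i) ^+ 2 + y ^+ 2).
    by rewrite big_split /= sumr_const card_ord mulr_natl.
  rewrite mulr_sumr mulr_suml; apply: ler_sum => i _.
  by have := sqr_ge0 (x (widen_ord (leqnSn n) i) - y); lra.
rewrite -natr1; nra.
Qed.

(** Cauchy-Schwarz in the recurrence costs a factor [n + 1]. What remains is a sum of
    [(i + 1)^2 |g_(i+1)|^2 |h_(n-i)|^2], and since [(i + 1)^2 |g_(i+1)|^2] is [i + 1] times the
    [(i+1)]-st exponent of [H], it is bounded by the recurrence for [H]. *)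
Lemma exp_rec_majorant g d a b H : exp_rec g d a b ->
  exp_rec (fun k => k%:R * (g k ^+ 2 + d k ^+ 2)) (fun=> 0) H (fun=> 0) ->
  forall n, a n ^+ 2 + b n ^+ 2 <= H n.
Proof.
move=> [a0 b0 Ha Hb] [H0 _ HH _]; elim/ltn_ind => -[_|n IH].
  by rewrite a0 b0 H0 expr1n expr0n addr0.
have n0 : 0 < n.+1%:R :> R by rewrite ltr0Sn.
rewrite -(ler_pM2l (mulr_gt0 n0 n0)).
have -> : n.+1%:R * n.+1%:R * (a n.+1 ^+ 2 + b n.+1 ^+ 2) =
  (n.+1%:R * a n.+1) ^+ 2 + (n.+1%:R * b n.+1) ^+ 2 by ring.
rewrite Ha Hb -mulrA HH.
apply: le_trans (lerD (sqr_sum_le _) (sqr_sum_le _)) _.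
rewrite -mulrDr ler_pM2l// -big_split; apply: ler_sum => i _ /=.
have -> : (i.+1%:R * (g i.+1 * a (n - i)%N - d i.+1 * b (n - i)%N)) ^+ 2 +
  (i.+1%:R * (g i.+1 * b (n - i)%N + d i.+1 * a (n - i)%N)) ^+ 2 =
  (i.+1%:R ^+ 2 * (g i.+1 ^+ 2 + d i.+1 ^+ 2)) *
  (a (n - i)%N ^+ 2 + b (n - i)%N ^+ 2) by ring.
rewrite mul0r subr0 mulrA [X in _ <= X * _]mulrA -expr2.
rewrite ler_wpM2l ?IH ?ltnS ?leq_subr//.
by rewrite mulr_ge0 ?sqr_ge0// addr_ge0 ?sqr_ge0.
Qed.

(** Mean value theorem on [[0, 1]] for the real part of [e^(-G) P], with [P = p1 + i p2] and
    [G = g1 + i g2]. The derivative is the real part of [e^(-G) (P' - G' P)], and [P' - G' P] has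
    only high-degree terms when [P] truncates the series of [e^G]. *)
Lemma exp_poly_mvt (p1 p2 g1 g2 : {poly R}) : g1.[0] = 0 -> g2.[0] = 0 ->
  exists2 c, 0 < c < 1 &
  expR (- g1.[1]) * (p1.[1] * cos g2.[1] + p2.[1] * sin g2.[1]) - p1.[0] =
  expR (- g1.[c]) * ((p1^`() - g1^`() * p1 + g2^`() * p2).[c] * cos g2.[c]
                   + (p2^`() - g1^`() * p2 - g2^`() * p1).[c] * sin g2.[c]).
Proof.
move=> g10 g20.
have [c _|c c01 E] := @mvt_deriv R
  (fun t => expR (- g1.[t]) * (p1.[t] * cos g2.[t] + p2.[t] * sin g2.[t]))
  (fun t => expR (- g1.[t]) * ((p1^`() - g1^`() * p1 + g2^`() * p2).[t] * cos g2.[t]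
                   + (p2^`() - g1^`() * p2 - g2^`() * p1).[t] * sin g2.[t])) _ _ ltr01.
  deriv; [exact: is_derive_poly..|rewrite !(hornerD, hornerN, hornerM)]; ring.
exists c => //; move: E; rewrite subr0 mulr1 => <-.
by rewrite g10 g20 oppr0 expR0 cos0 sin0; ring.
Qed.

Lemma coef_poly_vanish g N : (forall k, (N < k)%N -> g k = 0) ->
  forall k, (\poly_(i < N.+1) g i)`_k = g k.
Proof. by move=> gN k; rewrite coef_poly ltnS; case: leqP => // /gN. Qed.

Lemma horner_poly1 g N : (\poly_(i < N) g i).[1] = \sum_(i < N) g i.
Proof. by rewrite horner_poly; apply: eq_bigr => i _; rewrite expr1n mulr1. Qed.

Lemma horner_poly0 g N : (\poly_(i < N.+1) g i).[0] = g 0%N.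
Proof. by rewrite horner_coef0 coef_poly. Qed.

(** All coefficients of [p' - q' p] are nonpositive: below degree [M] the recurrence makes them
    vanish, and from there on only [- q' p] is left. Hence [e^(-q) p] at [1] is at most its value
    [1] at [0]. *)
Lemma exp_rec_sum_le A H N M : A 0%N = 0 -> (forall k, 0 <= A k) ->
  (forall k, (N < k)%N -> A k = 0) -> exp_rec A (fun=> 0) H (fun=> 0) ->
  \sum_(n < M.+1) H n <= expR (\sum_(k < N.+1) A k).
Proof.
move=> A0 Age0 AN HA; have Hge0 := exp_rec_real_ge0 Age0 HA.
have [H0 _ HH _] := HA.
set p := \poly_(n < M.+1) H n; set q := \poly_(k < N.+1) A k.
have [||c /andP[c0 _]] := @exp_poly_mvt p 0 q 0.
- by rewrite horner_poly0.
- by rewrite horner0.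
rewrite !horner0 cos0 sin0 !mulr0 !addr0 !mulr1 !horner_poly1 horner_poly0 H0.
move=> E.
have : expR (- q.[c]) * (p^`() - q^`() * p).[c] <= 0.
  apply: mulr_ge0_le0; first exact: expR_ge0.
  rewrite -oppr_ge0 -hornerN horner_coef sumr_ge0// => n _.
  rewrite mulr_ge0 ?exprn_ge0 ?(ltW c0)// coefN coefB opprB coef_deriv coefM.
  have qE i : (q^`())`_i = i.+1%:R * A i.+1.
    by rewrite coef_deriv coef_poly_vanish// mulr_natl.
  have [nM|Mn] := ltnP n M.
    rewrite coef_poly ltnS nM -[H _ *+ _]mulr_natl HH subr_ge0.
    rewrite le_eqVlt; apply/orP; left; apply/eqP; apply: eq_bigr => i _.
    rewrite qE mul0r subr0 coef_poly ltnS (leq_trans (leq_subr _ _) (ltnW nM)).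
    by rewrite mulrA.
  rewrite coef_poly ltnNge ltnS Mn /= mul0rn subr0 sumr_ge0// => i _.
  by rewrite qE !mulr_ge0// coef_poly; case: ifP.
rewrite -E subr_le0 expRN mulrC ler_pdivrMr ?expR_gt0// mul1r; exact.
Qed.

Lemma sum_vanish_le (f : nat -> R) N n : (forall k, 0 <= f k) ->
  (forall k, (N <= k)%N -> f k = 0) -> \sum_(i < n) f i <= \sum_(i < N) f i.
Proof.
move=> f0 fN; have [nN|Nn] := leqP n N.
  by rewrite -(subnKC nN) big_split_ord /= lerDl sumr_ge0.
rewrite -(subnKC (ltnW Nn)) big_split_ord /= [X in _ + X]big1 ?addr0// => i _.
by rewrite fN// leq_addr.
Qed.

(* Truncating the series after [M] leaves in [p' - q' p] only the coefficients
   from [M] on, and these involve the last [N] coefficients kept. *)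
Lemma truncation_coef_le g a c N M n (eta : R) : 0 <= eta ->
  (forall k, `|g k| <= c k) -> (forall k, (N < k)%N -> c k = 0) ->
  (forall j, (M <= j + N)%N -> `|a j| <= eta) -> (M <= n)%N ->
  `|((\poly_(k < N.+1) g k)^`() * \poly_(j < M.+1) a j)`_n| <=
  (\sum_(i < N) i.+1%:R * c i.+1) * eta.
Proof.
move=> eta0 gc cN aeta Mn.
have c0 k : 0 <= c k by rewrite (le_trans _ (gc k)).
have gN k : (N < k)%N -> g k = 0.
  by move=> /cN ck; apply/eqP; rewrite -normr_le0 -ck.
rewrite coefM (le_trans (ler_norm_sum _ _ _))//.
apply: (@le_trans _ _ (\sum_(i < n.+1) i.+1%:R * c i.+1 * eta)).
  apply: ler_sum => i _.
  rewrite coef_deriv coef_poly_vanish// -[g i.+1 *+ _]mulr_natl.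
  rewrite !normrM [ `|i.+1%:R| ]ger0_norm//.
  have [Ni|iN] := leqP N i.
    have -> : g i.+1 = 0 by rewrite gN// ltnS.
    by rewrite normr0 mulr0 mul0r !mulr_ge0.
  rewrite ler_pM// ?ler_wpM2l// coef_poly; case: ifP => _; last by rewrite normr0.
  apply: aeta; rewrite (leq_trans Mn)// -[X in (X <= _)%N](subnK (leq_ord i)).
  by rewrite leq_add2l ltnW.
rewrite -mulr_suml ler_wpM2r//.
apply: (@sum_vanish_le (fun i => i.+1%:R * c i.+1)) => k.
  by rewrite mulr_ge0.
by move=> Nk; rewrite cN ?mulr0// ltnS.
Qed.

Lemma horner_tail_le (r : {poly R}) M L (B t : R) : 0 <= t <= 1 ->
  (forall n, (n < M)%N -> r`_n = 0) -> (forall n, (M + L <= n)%N -> r`_n = 0) ->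
  (forall n, (M <= n)%N -> `|r`_n| <= B) -> `|r.[t]| <= L%:R * B.
Proof.
move=> /andP[t0 t1] rM rL rB.
have sz : (size r <= M + L)%N by apply/leq_sizeP => j; exact: rL.
rewrite (horner_coef_wide _ sz) big_split_ord /= big1 ?add0r; last first.
  by move=> i _; rewrite rM ?mul0r.
rewrite (le_trans (ler_norm_sum _ _ _))//.
rewrite mulr_natl -[L in _ *+ L]card_ord -sumr_const; apply: ler_sum => i _.
rewrite normrM (le_trans _ (rB (M + i)%N (leq_addr _ _)))// ler_piMr//.
by rewrite ger0_norm ?exprn_ge0// exprn_ile1.
Qed.

(** The real part of [e^(-G) P] equals [1] at [0] and moves only through the residual [P' - G' P].
    Its real and imaginary parts have at most [N + 1] nonzero coefficients, in degrees [M] to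
    [M + N], each a sum of two products; this gives the factor [4 * N.+1%:R]. Stating the error
    through the majorant [c] makes it uniform under rotation. *)
Lemma exp_truncation_lower g d a b c N M (eta : R) : 0 <= eta ->
  exp_rec g d a b -> g 0%N = 0 -> d 0%N = 0 ->
  (forall k, `|g k| <= c k) -> (forall k, `|d k| <= c k) ->
  (forall k, (N < k)%N -> c k = 0) ->
  (forall j, (M <= j + N)%N -> `|a j| <= eta) ->
  (forall j, (M <= j + N)%N -> `|b j| <= eta) ->
  1 - expR (\sum_(k < N.+1) c k) * (4 * N.+1%:R *
     (\sum_(i < N) i.+1%:R * c i.+1)) * eta <=
  expR (- \sum_(k < N.+1) g k) * ((\sum_(n < M.+1) a n) * cos (\sum_(k < N.+1) d k)
     + (\sum_(n < M.+1) b n) * sin (\sum_(k < N.+1) d k)).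
Proof.
move=> eta0 [a0 b0 Ha Hb] g0 d0 gc dc cN aeta beta.
set L := \sum_(i < N) _.
have gN k : (N < k)%N -> g k = 0.
  by move=> /cN ck; apply/eqP; rewrite -normr_le0 -ck.
have dN k : (N < k)%N -> d k = 0.
  by move=> /cN ck; apply/eqP; rewrite -normr_le0 -ck.
set p1 := \poly_(n < M.+1) a n; set p2 := \poly_(n < M.+1) b n.
set g1 := \poly_(k < N.+1) g k; set g2 := \poly_(k < N.+1) d k.
have [||t /andP[t0 t1]] := @exp_poly_mvt p1 p2 g1 g2.
- by rewrite horner_poly0.
- by rewrite horner_poly0.
rewrite !horner_poly1 horner_poly0 a0.
set r1 := _ - _ + _; set r2 := _ - _ - _ => E.
have t01 : 0 <= t <= 1 by rewrite !ltW.
have g1E i : (g1^`())`_i = i.+1%:R * g i.+1.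
  by rewrite coef_deriv coef_poly_vanish// mulr_natl.
have g2E i : (g2^`())`_i = i.+1%:R * d i.+1.
  by rewrite coef_deriv coef_poly_vanish// mulr_natl.
have pE (f : nat -> R) n (i : 'I_n.+1) : (n < M)%N -> (\poly_(j < M.+1) f j)`_(n - i) = f (n - i)%N.
  by move=> nM; rewrite coef_poly ltnS (leq_trans (leq_subr _ _) (ltnW nM)).
have p'0 (f : nat -> R) n : (M <= n)%N -> ((\poly_(j < M.+1) f j)^`())`_n = 0.
  by move=> Mn; rewrite coef_deriv coef_poly ltnNge ltnS Mn /= mul0rn.
have gp0 (h f : nat -> R) n : (M + N.+1 <= n)%N ->
    ((\poly_(k < N.+1) h k)^`() * \poly_(j < M.+1) f j)`_n = 0.
  move=> Mn; rewrite coefM big1// => i _; rewrite coef_deriv !coef_poly ltnS.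
  case: ltnP => iN; last by rewrite mul0rn mul0r.
  rewrite ifF ?mulr0//; apply/negbTE; rewrite -leqNgt.
  rewrite -(leq_add2r i) subnK ?leq_ord// (leq_trans _ Mn)//.
  by rewrite addSn -addnS leq_add2l ltnS ltnW.
have hr1 : `|r1.[t]| <= N.+1%:R * (2 * (L * eta)).
  apply: (@horner_tail_le _ M) => // n nM.
  - rewrite coefD coefB !coefM coef_deriv coef_poly ltnS nM -mulr_natl Ha.
    rewrite -sumrB -big_split big1// => i _ /=.
    by rewrite g1E g2E !pE//; ring.
  - rewrite coefD coefB p'0 ?gp0 ?subrr ?addr0//.
    by rewrite (leq_trans _ nM)// leq_addr.
  - rewrite coefD coefB p'0// sub0r (le_trans (ler_normD _ _))// normrN.
    by rewrite mulr_natl mulr2n lerD//; apply: truncation_coef_le.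
have hr2 : `|r2.[t]| <= N.+1%:R * (2 * (L * eta)).
  apply: (@horner_tail_le _ M) => // n nM.
  - rewrite !coefB !coefM coef_deriv coef_poly ltnS nM -mulr_natl Hb.
    rewrite -!sumrB big1// => i _ /=.
    by rewrite g1E g2E !pE//; ring.
  - rewrite !coefB p'0 ?gp0 ?subrr//.
    by rewrite (leq_trans _ nM)// leq_addr.
  - rewrite !coefB p'0// sub0r (le_trans (ler_normB _ _))// normrN.
    by rewrite mulr_natl mulr2n lerD//; apply: truncation_coef_le.
have he : expR (- g1.[t]) <= expR (\sum_(k < N.+1) c k).
  rewrite ler_expR horner_poly -sumrN; apply: ler_sum => i _.
  rewrite (le_trans (ler_norm _))// normrN normrM (le_trans _ (gc i))//.
  by rewrite ler_piMr// ger0_norm ?exprn_ge0 ?(ltW t0)// exprn_ile1 ?ltW.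
move: E => /eqP; rewrite subr_eq => /eqP ->.
set X := r1.[t] * _ + _.
have hX : `|X| <= 4 * N.+1%:R * L * eta.
  have h1 : `|r1.[t] * cos g2.[t]| <= `|r1.[t]|.
    by rewrite normrM ler_piMr// cos_max.
  have h2 : `|r2.[t] * sin g2.[t]| <= `|r2.[t]|.
    by rewrite normrM ler_piMr// sin_max.
  rewrite (le_trans (ler_normD _ _))// (le_trans (lerD h1 h2))//.
  rewrite (le_trans (lerD hr1 hr2))// le_eqVlt; apply/orP; left; apply/eqP; ring.
have hXe : `|expR (- g1.[t]) * X| <=
  expR (\sum_(k < N.+1) c k) * (4 * N.+1%:R * L) * eta.
  rewrite normrM -mulrA ler_pM// ger0_norm ?expR_ge0//.
by move: hXe; rewrite ler_norml => /andP[+ _]; lra.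
Qed.

Lemma exp_rec_vanishing a b (B eta : R) : 0 < eta ->
  (forall M, \sum_(n < M) (a n ^+ 2 + b n ^+ 2) <= B) ->
  exists M0, forall j, (M0 <= j)%N -> `|a j| <= eta /\ `|b j| <= eta.
Proof.
move=> eta0 Hab.
set u := fun n => a n ^+ 2 + b n ^+ 2.
have u0 n : 0 <= u n by rewrite addr_ge0 ?sqr_ge0.
have cu : cvgn (series u).
  apply: nondecreasing_is_cvgn.
    apply/nondecreasing_seqP => n; rewrite !seriesEnat /= big_nat_recr//=.
    by rewrite lerDl.
  exists B => _ [n _ <-]; rewrite seriesEord /=; exact: Hab.
have /cvgrPdist_lt /(_ (eta ^+ 2)) := cvg_series_cvg_0 cu.
case; first by rewrite exprn_gt0.
move=> M0 _ HM; exists M0 => j Mj.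
have := HM j Mj; rewrite /= sub0r normrN ger0_norm// /u => h.
split; rewrite -(ler_pXn2r (ltn0Sn 1)) ?nnegrE ?(ltW eta0)// real_normK ?num_real//.
  by have := sqr_ge0 (b j); lra.
by have := sqr_ge0 (a j); lra.
Qed.

(** A one-sided bound of [e^(2 Re G)] by the squared modulus of the truncated series is enough for
    an integral inequality. [M] is chosen before [x], so that the bound can be integrated. *)
Lemma exp_coefficients g d N : (2 <= N)%N -> g 0%N = 0 -> d 0%N = 0 ->
  (forall k, (N < k)%N -> g k = 0) -> (forall k, (N < k)%N -> d k = 0) ->
  exists a b,
  (forall M, (2 <= M)%N -> \sum_(n < M.+1) (a n ^+ 2 + b n ^+ 2) <=
     expR (\sum_(k < N.+1) k%:R * (g k ^+ 2 + d k ^+ 2)) -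
     ((g 2%N - (g 1%N ^+ 2 - d 1%N ^+ 2) / 2) ^+ 2 + (d 2%N - g 1%N * d 1%N) ^+ 2)) /\
  (forall e, 0 < e < 1 -> exists2 M, (2 <= M)%N & forall x,
     (1 - e) ^+ 2 * expR (2 * \sum_(k < N.+1)
        (g k * cos (k%:R * x) - d k * sin (k%:R * x))) <=
     (\sum_(n < M.+1) (a n * cos (n%:R * x) - b n * sin (n%:R * x))) ^+ 2 +
     (\sum_(n < M.+1) (a n * sin (n%:R * x) + b n * cos (n%:R * x))) ^+ 2).
Proof.
move=> N2 g0 d0 gN dN; have [a [b Hab]] := exp_rec_exists g d.
exists a, b; have [a0 b0 Ha Hb] := Hab.
pose A k := k%:R * (g k ^+ 2 + d k ^+ 2).
have A0 k : 0 <= A k by rewrite mulr_ge0// addr_ge0 ?sqr_ge0.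
have [H HA] := exp_rec_real A; have [H0 _ HH _] := HA.
have Hge0 := exp_rec_real_ge0 A0 HA.
have maj := exp_rec_majorant Hab HA.
have sumH M : \sum_(n < M.+1) H n <= expR (\sum_(k < N.+1) A k).
  apply: exp_rec_sum_le => //; first by rewrite /A mul0r.
  by move=> k Nk; rewrite /A gN// dN// expr0n addr0 mulr0.
set D := _ ^+ 2 + _ ^+ 2.
(* Here [h_2 = g_2 + g_1^2 / 2] and [H_2 = 2 |g_2|^2 + |g_1|^4 / 2], so the parallelogram identity
   gives the defect [|g_2 - g_1^2 / 2|^2] with equality. *)
have HD : a 2%N ^+ 2 + b 2%N ^+ 2 <= H 2%N - D.
  have := Ha 0%N; have := Hb 0%N; have := HH 0%N.
  have := Ha 1%N; have := Hb 1%N; have := HH 1%N.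
  rewrite !big_ord_recr !big_ord0 /= !subn0 subnn a0 b0 H0.
  rewrite !(mul1r, mulr1, mulr0, mul0r, subr0, addr0, add0r) => eH2 eb2 ea2 eH1 eb1 ea1.
  rewrite /D; move: eH2 eb2 ea2; rewrite eH1 eb1 ea1 /A.
  move=> eH2 eb2 ea2.
  have -> : a 2%N = (2 * a 2%N) / 2 by field.
  have -> : b 2%N = (2 * b 2%N) / 2 by field.
  have -> : H 2%N = (2 * H 2%N) / 2 by field.
  rewrite eH2 eb2 ea2 le_eqVlt; apply/orP; left; apply/eqP; by field.
split.
  move=> M M2; apply: (@le_trans _ _ (\sum_(n < M.+1) (H n - (n == 2 :> nat)%:R * D))).
    apply: ler_sum => n _; case: eqP => [->|_]; first by rewrite mul1r.
    by rewrite mul0r subr0 maj.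
  rewrite sumrB lerB//.
  have M2' : (2 < M.+1)%N by [].
  rewrite (bigD1 (Ordinal M2')) //= mul1r lerDl sumr_ge0// => i _.
  by rewrite mulr_ge0// addr_ge0 ?sqr_ge0.
move=> e /andP[e0 e1].
pose c k := `|g k| + `|d k|.
set K := expR (\sum_(k < N.+1) c k) * (4 * N.+1%:R * (\sum_(i < N) i.+1%:R * c i.+1)).
have c0 k : 0 <= c k by rewrite addr_ge0.
have K0 : 0 <= K.
  by rewrite !mulr_ge0 ?expR_ge0// sumr_ge0// => i _; rewrite mulr_ge0.
pose eta := e / (K + 1).
have eta0 : 0 < eta by rewrite divr_gt0// ltr_wpDl.
have Keta : K * eta <= e.
  by rewrite /eta mulrCA ler_piMr ?(ltW e0)// ler_pdivrMr ?ltr_wpDl// mul1r lerDl.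
(* Halved because a rotated coefficient is bounded by [|a j| + |b j|]. *)
have eta20 : 0 < eta / 2 by rewrite divr_gt0.
have [|M0 HM0] := @exp_rec_vanishing a b (expR (\sum_(k < N.+1) A k)) (eta / 2) eta20.
  move=> [|M]; first by rewrite big_ord0 expR_ge0.
  by rewrite (le_trans _ (sumH M))//; apply: ler_sum => i _; exact: maj.
exists (M0 + N)%N; first by rewrite (leq_trans N2)// leq_addl.
move=> x; set M := (M0 + N)%N.
have rot := exp_rec_rotate x Hab.
set G := \sum_(k < N.+1) (_ - _).
set P1 := \sum_(n < M.+1) (_ - _); set P2 := \sum_(n < M.+1) (_ + _).
have tri (p q y : R) : `|p * cos y - q * sin y| <= `|p| + `|q|.
  rewrite (le_trans (ler_normB _ _))// !normrM.
  by rewrite lerD// ler_piMr// ?cos_max ?sin_max.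
have tri' (p q y : R) : `|p * sin y + q * cos y| <= `|p| + `|q|.
  rewrite (le_trans (ler_normD _ _))// !normrM.
  by rewrite lerD// ler_piMr// ?cos_max ?sin_max.
have cN k : (N < k)%N -> c k = 0 by move=> Nk; rewrite /c gN// dN// normr0 addr0.
have low := @exp_truncation_lower _ _ _ _ c N M eta (ltW eta0) rot.
have : 1 - K * eta <= expR (- G) * (P1 * cos (\sum_(k < N.+1)
    (g k * sin (k%:R * x) + d k * cos (k%:R * x))) + P2 * sin (\sum_(k < N.+1)
    (g k * sin (k%:R * x) + d k * cos (k%:R * x)))).
  apply: low => //.
  - by rewrite g0 d0 !mul0r subrr.
  - by rewrite g0 d0 !mul0r addr0.
  - move=> j; rewrite leq_add2r => /HM0[h1 h2].
    by rewrite (le_trans (tri _ _ _))//; lra.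
  - move=> j; rewrite leq_add2r => /HM0[h1 h2].
    by rewrite (le_trans (tri' _ _ _))//; lra.
set y := \sum_(k < N.+1) _ => h.
have h1 : expR G * (1 - e) <= P1 * cos y + P2 * sin y.
  rewrite -ler_pdivlMl ?expR_gt0// -expRN (le_trans _ h)//; lra.
have cs := cos2Dsin2 y.
have -> : (1 - e) ^+ 2 * expR (2 * G) = (expR G * (1 - e)) ^+ 2.
  by rewrite (_ : 2 * G = G + G) ?expRD; ring.
apply: (@le_trans _ _ ((P1 * cos y + P2 * sin y) ^+ 2)).
  by rewrite ler_pXn2r// nnegrE ?(le_trans _ h1)// mulr_ge0 ?expR_ge0//; lra.
have := sqr_ge0 (P1 * sin y - P2 * cos y).
have -> : P1 ^+ 2 + P2 ^+ 2 = (P1 ^+ 2 + P2 ^+ 2) * (cos y ^+ 2 + sin y ^+ 2).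
  by rewrite cs mulr1.
move=> /le_trans hle; rewrite -subr_ge0; apply: hle.
by rewrite le_eqVlt; apply/orP; left; apply/eqP; ring.
Qed.

End exponential_coefficients.

(** * Integration on the torus and the Lebedev-Milin inequality *)

Section torus_integral.
Variable R : realType.
Local Notation mu := (@lebesgue_measure R).
Local Notation Tor := (@Defs.Tor R).
Implicit Types (f h : R -> R).

Definition tint f : R := Rintegral mu Tor f.
Definition tintegrable f : Prop := mu.-integrable Tor (EFin \o f).
Definition tbounded f : Prop :=
  measurable_fun Tor f /\ exists M, forall x, Tor x -> `|f x| <= M.

Lemma measurable_Tor :
  measurable (Tor : set (g_sigma_algebraType (R.-ocitv.-measurable))).
Proof. exact: measurable_itv. Qed.
Hint Resolve measurable_Tor : core.

Lemma measure_Tor : mu Tor = 1%E.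
Proof.
rewrite /Tor lebesgue_measure_itv /= lte_fin ifT; last by lra.
by rewrite -EFinB; congr (_%:E); lra.
Qed.

Lemma tintegrable_tbounded f : tbounded f -> tintegrable f.
Proof.
move=> [mf [M HM]]; apply: measurable_bounded_integrable => //.
  by rewrite [X in (X < _)%E](_ : _ = 1%E) ?ltry//; exact: measure_Tor.
exists M; split; first exact: num_real.
by move=> y My x Tx; exact: le_trans (HM x Tx) (ltW My).
Qed.

Lemma tintegrable_measurable f : tintegrable f -> measurable_fun Tor f.
Proof. by move=> /integrableP[/measurable_EFinP]. Qed.

Lemma tint_cst (c : R) : tint (fun=> c) = c.
Proof.
rewrite /tint Rintegral_cst// [X in fine X](_ : _ = 1%E) ?mulr1//.
exact: measure_Tor.
Qed.

Lemma eq_tint f h : (forall x, Tor x -> f x = h x) -> tint f = tint h.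
Proof. by move=> fh; apply: eq_Rintegral => x /set_mem; exact: fh. Qed.

Lemma tintD f h : tintegrable f -> tintegrable h ->
  tint (fun x => f x + h x) = tint f + tint h.
Proof. by move=> *; exact: RintegralD. Qed.

Lemma tintB f h : tintegrable f -> tintegrable h ->
  tint (fun x => f x - h x) = tint f - tint h.
Proof. by move=> *; exact: RintegralB. Qed.

Lemma tintZl (c : R) f : tintegrable f -> tint (fun x => c * f x) = c * tint f.
Proof. by move=> *; exact: RintegralZl. Qed.

Lemma tintZr f (c : R) : tintegrable f -> tint (fun x => f x * c) = tint f * c.
Proof. by move=> *; exact: RintegralZr. Qed.

Lemma tintegrableD f h : tintegrable f -> tintegrable h ->
  tintegrable (fun x => f x + h x).
Proof. by move=> ff fh; exact: (integrableD measurable_Tor ff fh). Qed.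

Lemma tintegrableB f h : tintegrable f -> tintegrable h ->
  tintegrable (fun x => f x - h x).
Proof. by move=> ff fh; exact: (integrableB measurable_Tor ff fh). Qed.

Lemma tintegrableZl (c : R) f : tintegrable f -> tintegrable (fun x => c * f x).
Proof. by move=> ff; exact: (integrableZl measurable_Tor c ff). Qed.

Lemma tintegrable_sum (I : Type) (s : seq I) (F : I -> R -> R) :
  (forall i, tintegrable (F i)) -> tintegrable (fun x => \sum_(i <- s) F i x).
Proof.
move=> HF; rewrite /tintegrable.
rewrite (_ : _ \o _ = (fun x => \sum_(i <- s) (F i x)%:E)%E).
  by apply: integrable_sum => // i _; exact: HF.
by apply/funext => x /=; rewrite sumEFin.
Qed.

Lemma tint_sum (I : Type) (s : seq I) (F : I -> R -> R) :
  (forall i, tintegrable (F i)) ->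
  tint (fun x => \sum_(i <- s) F i x) = \sum_(i <- s) tint (F i).
Proof.
move=> HF; elim: s => [|i s IH].
  rewrite big_nil -[RHS](tint_cst 0); apply: eq_tint => x _; exact: big_nil.
rewrite big_cons -IH -tintD//; last exact: tintegrable_sum.
by apply: eq_tint => x _; rewrite big_cons.
Qed.

Lemma le_tint f h : tintegrable f -> tintegrable h ->
  (forall x, Tor x -> f x <= h x) -> tint f <= tint h.
Proof. by move=> *; exact: le_Rintegral. Qed.

Lemma tint_ge0 f : (forall x, Tor x -> 0 <= f x) -> 0 <= tint f.
Proof. by move=> f0; apply: Rintegral_ge0 => x; exact: f0. Qed.

Lemma tint_norm f : tintegrable f -> `|tint f| <= tint (fun x => `|f x|).
Proof. by move=> *; exact: le_normr_Rintegral. Qed.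

Lemma tintE f : tintegrable f -> (\int[mu]_(x in Tor) (f x)%:E)%E = (tint f)%:E.
Proof. by move=> ff; rewrite /tint /Rintegral fineK// integrable_fin_num. Qed.

Lemma tintegrable_norm f : tintegrable f -> tintegrable (fun x => `|f x|).
Proof. exact: integrable_norm. Qed.

Lemma tbounded_cst (c : R) : tbounded (fun=> c).
Proof. by split => //; exists `|c|. Qed.

Lemma tbounded_continuous f : continuous f -> tbounded f.
Proof.
move=> cf; split.
  by apply: measurable_funTS; exact: continuous_measurable_fun.
have /continuous_compact : {within `[(- 2^-1), (2^-1 : R)], continuous f}.
  exact: continuous_subspaceT.
move=> /(_ (@segment_compact R _ _))/compact_bounded[M [_ HM]].
exists (M + 1) => x Tx; apply: (HM (M + 1)); first by rewrite ltrDl.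
exists x => //; move: Tx; rewrite /Tor /= !in_itv /= => /andP[-> /ltW ->]//.
Qed.

Lemma tboundedM f h : tbounded f -> tbounded h -> tbounded (fun x => f x * h x).
Proof.
move=> [mf [M HM]] [mh [L HL]]; split; first exact: measurable_funM.
by exists (M * L) => x Tx; rewrite normrM ler_pM// ?HM// HL.
Qed.

Lemma tboundedD f h : tbounded f -> tbounded h -> tbounded (fun x => f x + h x).
Proof.
move=> [mf [M HM]] [mh [L HL]]; split; first exact: measurable_funD.
by exists (M + L) => x Tx; rewrite (le_trans (ler_normD _ _))// lerD// ?HM// HL.
Qed.

Lemma tbounded_sum (I : Type) (s : seq I) (F : I -> R -> R) :
  (forall i, tbounded (F i)) -> tbounded (fun x => \sum_(i <- s) F i x).
Proof.
move=> HF; elim: s => [|i s IH].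
  rewrite (_ : (fun x => _) = fun=> 0); first exact: tbounded_cst.
  by apply/funext => x; rewrite big_nil.
rewrite (_ : (fun x => _) = fun x => F i x + \sum_(j <- s) F j x).
  exact: tboundedD.
by apply/funext => x; rewrite big_cons.
Qed.

Lemma tintegrableM f h : tbounded h -> tintegrable f ->
  tintegrable (fun x => f x * h x).
Proof.
move=> [mh [M HM]] ff; rewrite /tintegrable.
rewrite (_ : _ \o _ = (EFin \o f) \* (EFin \o h))%E//.
apply: (integrableMl measurable_Tor ff mh).
exists M; split; first exact: num_real.
by move=> y My x Tx; exact: le_trans (HM x Tx) (ltW My).
Qed.

Lemma tint_deriv f (F : R -> R) : continuous f -> (forall x : R, is_derive x 1 F (f x)) ->
  tint f = F 2^-1 - F (- 2^-1).
Proof.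
move=> cf dF.
have lt12 : - 2^-1 < 2^-1 :> R by lra.
have cF x : {for x, continuous F} by exact: is_derive_continuous (dF x).
rewrite /tint /Tor Rintegral_itv_bndo_bndc; last first.
  exact/tintegrable_tbounded/tbounded_continuous.
rewrite /Rintegral (continuous_FTC2 lt12 _ (F := F))//.
- exact: continuous_subspaceT.
- split.
  + by move=> x _; have [] := dF x.
  + exact/cvg_at_right_filter/cF.
  + exact/cvg_at_left_filter/cF.
- by move=> x _; rewrite derive1E; have [_ ->] := dF x.
Qed.

(** Integer multiples of [phase] give the even frequencies, the ones the kernel sees. [half_phase]
    gives all frequencies and serves the Fourier coefficients of arbitrary index. *)
Definition half_phase (x : R) : R := 2 * pi * x.
Definition phase (x : R) : R := 4 * pi * x.

Lemma is_derive_half_phase (x : R) : is_derive x 1 half_phase (2 * pi).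
Proof. by rewrite /half_phase; deriv; rewrite mulr1 mulr0 addr0. Qed.

Lemma continuous_trig (a x : R) :
  {for x, continuous (fun x => cos (a * half_phase x))} /\
  {for x, continuous (fun x => sin (a * half_phase x))}.
Proof.
have dp := is_derive_mulf (is_derive_constf a x) (is_derive_half_phase x).
by split; [exact: is_derive_continuous (is_derive_cosf dp)|
           exact: is_derive_continuous (is_derive_sinf dp)].
Qed.

Lemma tbounded_cos_half (a : R) : tbounded (fun x => cos (a * half_phase x)).
Proof. by apply: tbounded_continuous => x; have [] := continuous_trig a x. Qed.

Lemma tbounded_sin_half (a : R) : tbounded (fun x => sin (a * half_phase x)).
Proof. by apply: tbounded_continuous => x; have [] := continuous_trig a x. Qed.

Lemma phase_half (a : R) x : a * phase x = (a * 2) * half_phase x.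
Proof. by rewrite /phase /half_phase; ring. Qed.

Lemma tbounded_cos (a : R) : tbounded (fun x => cos (a * phase x)).
Proof.
rewrite (_ : (fun x => _) = fun x => cos (a * 2 * half_phase x)).
  exact: tbounded_cos_half.
by apply/funext => x; rewrite phase_half.
Qed.

Lemma tbounded_sin (a : R) : tbounded (fun x => sin (a * phase x)).
Proof.
rewrite (_ : (fun x => _) = fun x => sin (a * 2 * half_phase x)).
  exact: tbounded_sin_half.
by apply/funext => x; rewrite phase_half.
Qed.

Lemma sin_int_pi (n m : nat) : sin ((n%:R - m%:R) * pi) = 0 :> R.
Proof. by rewrite mulrBl sinB !sin_natpi mul0r mulr0 subrr. Qed.

Lemma tint_cos_half (n m : nat) :
  tint (fun x => cos ((n%:R - m%:R) * half_phase x)) = (n == m)%:R.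
Proof.
have [->|nm] := eqVneq n m.
  rewrite -(tint_cst 1); apply: eq_tint => x _.
  by rewrite subrr mul0r cos0.
set a : R := n%:R - m%:R.
have a0 : a != 0 by rewrite subr_eq0 eqr_nat.
have pi0 : pi != 0 :> R by rewrite gt_eqF// pi_gt0.
notypeclasses refine (etrans (@tint_deriv _
  (fun x => sin (a * half_phase x) / (a * (2 * pi))) _ _) _).
- by move=> x; have [] := continuous_trig a x.
- move=> x; deriv; first exact: is_derive_half_phase.
  move: (cos _) (sin _) => c s; move: pi0; rewrite /half_phase.
  by move: (pi : R) => p p0; field; rewrite a0 p0.
- have -> : a * half_phase 2^-1 = a * pi by rewrite /half_phase; lra.
  have -> : a * half_phase (- 2^-1) = - (a * pi) by rewrite /half_phase; lra.
  by rewrite sinN sin_int_pi oppr0 mul0r subrr.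
Qed.

Lemma tint_sin_half (n m : nat) :
  tint (fun x => sin ((n%:R - m%:R) * half_phase x)) = 0.
Proof.
have [->|nm] := eqVneq n m.
  rewrite -(tint_cst 0); apply: eq_tint => x _.
  by rewrite subrr mul0r sin0.
set a : R := n%:R - m%:R.
have a0 : a != 0 by rewrite subr_eq0 eqr_nat.
have pi0 : pi != 0 :> R by rewrite gt_eqF// pi_gt0.
notypeclasses refine (etrans (@tint_deriv _
  (fun x => - cos (a * half_phase x) / (a * (2 * pi))) _ _) _).
- by move=> x; have [] := continuous_trig a x.
- move=> x; deriv; first exact: is_derive_half_phase.
  move: (cos _) (sin _) => c s; move: pi0; rewrite /half_phase.
  by move: (pi : R) => p p0; field; rewrite a0 p0.
- have -> : a * half_phase 2^-1 = a * pi by rewrite /half_phase; lra.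
  have -> : a * half_phase (- 2^-1) = - (a * pi) by rewrite /half_phase; lra.
  by rewrite cosN subrr.
Qed.

Lemma tint_cos (n m : nat) :
  tint (fun x => cos ((n%:R - m%:R) * phase x)) = (n == m)%:R.
Proof.
have -> : (n == m) = (n * 2 == m * 2)%N by rewrite eqn_pmul2r.
rewrite -tint_cos_half; apply: eq_tint => x _.
by rewrite phase_half mulrBl !natrM.
Qed.

Lemma tint_sin (n m : nat) : tint (fun x => sin ((n%:R - m%:R) * phase x)) = 0.
Proof.
rewrite -(tint_sin_half (n * 2) (m * 2)); apply: eq_tint => x _.
by rewrite phase_half mulrBl !natrM.
Qed.

Lemma parseval_poly (a b : nat -> R) (L : nat) :
  tint (fun x =>
    (\sum_(n < L) (a n * cos (n%:R * phase x) - b n * sin (n%:R * phase x))) ^+ 2 +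
    (\sum_(n < L) (a n * sin (n%:R * phase x) + b n * cos (n%:R * phase x))) ^+ 2)
  = \sum_(n < L) (a n ^+ 2 + b n ^+ 2).
Proof.
pose F (n m : nat) x := (a n * a m + b n * b m) * cos ((n%:R - m%:R) * phase x)
  + (a n * b m - b n * a m) * sin ((n%:R - m%:R) * phase x).
have iF n m : tintegrable (F n m).
  by apply: tintegrableD; apply: tintegrableZl; apply: tintegrable_tbounded;
    [exact: tbounded_cos|exact: tbounded_sin].
rewrite (@eq_tint _ (fun x => \sum_(n < L) \sum_(m < L) F n m x)); last first.
  move=> x _; rewrite !expr2 !big_distrlr /= -big_split; apply: eq_bigr => n _ /=.
  rewrite -big_split; apply: eq_bigr => m _ /=.
  by rewrite /F [(_ - _) * phase x]mulrBl cosB sinB; ring.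
rewrite tint_sum; last by move=> n; apply: tintegrable_sum => m.
apply: eq_bigr => n _; rewrite tint_sum//.
rewrite (bigD1 n)//= big1 ?addr0.
  rewrite /F tintD ?tintZl ?tint_cos ?tint_sin ?eqxx;
    [by rewrite mulr1 mulr0 addr0 -!expr2|..];
  by try apply: tintegrableZl; apply: tintegrable_tbounded;
    first [exact: tbounded_cos|exact: tbounded_sin].
move=> m mn; rewrite /F tintD ?tintZl ?tint_cos ?tint_sin.
- rewrite (_ : (n == m :> nat) = false) ?mulr0 ?addr0//.
  by apply/negbTE; rewrite eq_sym.
all: by try apply: tintegrableZl; apply: tintegrable_tbounded;
    first [exact: tbounded_cos|exact: tbounded_sin].
Qed.

Definition trig_poly (g d : nat -> R) N (x : R) : R :=
  \sum_(k < N.+1) (g k * cos (k%:R * phase x) - d k * sin (k%:R * phase x)).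

Lemma tbounded_trig_poly g d N : tbounded (trig_poly g d N).
Proof.
apply: tbounded_sum => k.
by apply: tboundedD; [|rewrite (_ : (fun x => _) = fun x => (- d k) * sin (k%:R * phase x));
   last by apply/funext => x; rewrite mulNr];
  apply: tboundedM; [exact: tbounded_cst|exact: tbounded_cos|exact: tbounded_cst|exact: tbounded_sin].
Qed.

Lemma tbounded_expR f : tbounded f -> tbounded (fun x => expR (f x)).
Proof.
move=> [mf [M HM]]; split.
  by apply: measurableT_comp => //; exact: measurable_expR.
exists (expR M) => x Tx; rewrite ger0_norm ?expR_ge0// ler_expR.
by rewrite (le_trans (ler_norm _))// HM.
Qed.

(* The deficit is the loss [H_2 - |h_2|^2] of the coefficientwise majorisation at order two. *)
Lemma lebedev_milin (g d : nat -> R) N : (2 <= N)%N -> g 0%N = 0 -> d 0%N = 0 ->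
  (forall k, (N < k)%N -> g k = 0) -> (forall k, (N < k)%N -> d k = 0) ->
  tint (fun x => expR (2 * trig_poly g d N x)) <=
  expR (\sum_(k < N.+1) k%:R * (g k ^+ 2 + d k ^+ 2)) -
  ((g 2%N - (g 1%N ^+ 2 - d 1%N ^+ 2) / 2) ^+ 2 + (d 2%N - g 1%N * d 1%N) ^+ 2).
Proof.
move=> N2 g0 d0 gN dN.
have [a [b [Hle Hlow]]] := exp_coefficients N2 g0 d0 gN dN.
set T := tint _; set B := _ - _.
have bE : tintegrable (fun x => expR (2 * trig_poly g d N x)).
  apply/tintegrable_tbounded/tbounded_expR/tboundedM; first exact: tbounded_cst.
  exact: tbounded_trig_poly.
have T0 : 0 <= T by apply: tint_ge0 => x _; exact: expR_ge0.
have key e : 0 < e < 1 -> (1 - e) ^+ 2 * T <= B.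
  move=> /Hlow[M M2 HM]; apply: le_trans (Hle M M2).
  rewrite -parseval_poly -tintZl//; apply: le_tint.
  - exact: tintegrableZl.
  - apply: tintegrable_tbounded; apply: tboundedD; apply: tboundedM;
    apply: tbounded_sum => n; apply: tboundedD;
    try (apply: tboundedM; [exact: tbounded_cst|]; first [exact: tbounded_cos|exact: tbounded_sin]);
    (rewrite (_ : (fun x => _) = fun x => (- b n) * sin (n%:R * phase x));
    [by apply: tboundedM; [exact: tbounded_cst|exact: tbounded_sin]|
     by apply/funext => x; rewrite mulNr]).
  - by move=> x _; exact: HM.
have B0 : 0 <= B.
  by apply: le_trans (key 2^-1 _); [rewrite mulr_ge0 ?sqr_ge0|lra].
rewrite leNgt; apply/negP => BT.
have T1 : 0 < T by exact: le_lt_trans BT.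
(* With this [e] the factor [(1 - e)^2] loses at most [2 e T = (T - B) / 2], half of the supposed
   excess. *)
have : (1 - (T - B) / (4 * T)) ^+ 2 * T <= B.
  apply: key; rewrite divr_gt0 ?subr_gt0 ?mulr_gt0//=.
  by rewrite ltr_pdivrMr ?mulr_gt0// mul1r; lra.
have : T - (T - B) / 2 <= (1 - (T - B) / (4 * T)) ^+ 2 * T.
  have -> : T - (T - B) / 2 = (1 - 2 * ((T - B) / (4 * T))) * T.
    by field; rewrite gt_eqF.
  rewrite ler_pM2r//; set e := _ / _; have := sqr_ge0 e; lra.
lra.
Qed.

End torus_integral.

(** * Densities, potentials and the free energy *)

Section densities.
Variable R : realType.
Local Notation mu := (@lebesgue_measure R).
Local Notation Tor := (@Defs.Tor R).
Implicit Types (p q : R -> R) (N k : nat).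

Lemma density_ge0 q x : is_density q -> Tor x -> 0 <= q x.
Proof. by move=> [_ [q0 _]]; exact: q0. Qed.

Lemma density_integrable q : is_density q -> tintegrable q.
Proof.
move=> [mq [q0 q1]]; apply/integrableP; split; first exact/measurable_EFinP.
rewrite (_ : (\int[_]_(x in _) _)%E = 1%E) ?ltry// -q1.
by apply: eq_integral => x /set_mem Tx /=; rewrite ger0_norm// q0.
Qed.

Lemma density_tint q : is_density q -> tint q = 1.
Proof. by move=> [_ [_ q1]]; rewrite /tint /Rintegral q1. Qed.

Lemma is_densityP q : measurable_fun Tor q -> (forall x, Tor x -> 0 <= q x) ->
  tintegrable q -> tint q = 1 -> is_density q.
Proof. by move=> mq q0 iq q1; split => //; split => //; rewrite tintE// q1. Qed.

Lemma density_q_u : is_density (@q_u R).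
Proof.
apply: is_densityP; [exact: measurable_cst|by move=> x _; exact: ler01| |exact: tint_cst].
exact/tintegrable_tbounded/tbounded_cst.
Qed.

Lemma tint_density_close q (f h : R -> R) (e : R) : is_density q ->
  tbounded f -> tbounded h -> (forall x, Tor x -> `|f x - h x| <= e) ->
  `|tint (fun x => f x * q x) - tint (fun x => h x * q x)| <= e.
Proof.
move=> dq bf bh H; have iq := density_integrable dq.
have ifq (g : R -> R) : tbounded g -> tintegrable (fun x => g x * q x).
  move=> bg; rewrite (_ : (fun x => _) = fun x => q x * g x).
    exact: tintegrableM.
  by apply/funext => x; rewrite mulrC.
have iB : tintegrable (fun x => f x * q x - h x * q x).
  by apply: tintegrableB; exact: ifq.
rewrite -tintB; [|exact: ifq..].
rewrite (le_trans (tint_norm iB))//.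
have -> : e = tint (fun x => e * q x) by rewrite tintZl// density_tint// mulr1.
apply: le_tint; [exact: tintegrable_norm|exact: tintegrableZl|].
move=> x Tx; rewrite -mulrBl normrM [ `|q x|]ger0_norm; last exact: density_ge0 Tx.
by rewrite ler_wpM2r ?H// (density_ge0 dq).
Qed.

(* [mode_cos q k - i mode_sin q k] is the Fourier coefficient of [q] at frequency [2 k];
   the kernel does not see odd frequencies. *)
Definition mode_cos q k : R := tint (fun x => q x * cos (k%:R * phase x)).
Definition mode_sin q k : R := tint (fun x => q x * sin (k%:R * phase x)).

(** * The kernel, its potentials and their mode expansions *)

Definition kern (t : R) : R := `|sin (2 * pi * t)|.

Lemma kern_ge0 t : 0 <= kern t. Proof. exact: normr_ge0. Qed.

Lemma kern_le1 t : kern t <= 1. Proof. exact: sin_max. Qed.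

Lemma sin_lipschitz (s t : R) : `|sin s - sin t| <= `|s - t|.
Proof.
have H (a b : R) : b < a -> `|sin a - sin b| <= `|a - b|.
  move=> ba; have [c _ ->] := @mvt_deriv R sin cos b a ba.
  by rewrite normrM ler_piMl// cos_max.
have [ts|st|->] := ltgtP t s; [by apply: H| |by rewrite !subrr].
by rewrite distrC (distrC s); apply: H.
Qed.

Lemma kern_lipschitz s t : `|kern s - kern t| <= 2 * pi * `|s - t|.
Proof.
rewrite (le_trans (ler_dist_dist _ _))// (le_trans (sin_lipschitz _ _))//.
by rewrite -mulrBr normrM ger0_norm// mulr_ge0// pi_ge0.
Qed.

Lemma lipschitz_continuous (f : R -> R) (L : R) :
  (forall s t, `|f s - f t| <= L * `|s - t|) -> continuous f.
Proof.
move=> H x; apply/cvgrPdist_lt => e e0; near=> y.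
rewrite (le_lt_trans (H _ _))//.
apply: (@le_lt_trans _ _ ((`|L| + 1) * `|x - y|)).
  by rewrite ler_wpM2r// (le_trans (ler_norm L))// lerDl.
rewrite -ltr_pdivlMl; last by rewrite ltr_wpDl.
near: y; apply/nbhs_ballP; exists ((`|L| + 1)^-1 * e) => //=.
by rewrite mulr_gt0// invr_gt0 ltr_wpDl.
Unshelve. all: by end_near.
Qed.

Lemma tbounded_kern x : tbounded (fun y => kern (x - y)).
Proof.
apply/tbounded_continuous/(@lipschitz_continuous _ (2 * pi)) => s t.
rewrite (le_trans (kern_lipschitz _ _))//.
by rewrite (_ : x - s - (x - t) = t - s) ?(distrC t)//; ring.
Qed.

Definition potential q x : R := tint (fun y => kern (x - y) * q y).

Lemma potential_integrable q x : is_density q ->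
  tintegrable (fun y => kern (x - y) * q y).
Proof.
move=> dq; rewrite (_ : (fun y => _) = fun y => q y * kern (x - y)).
  by apply: tintegrableM; [exact: tbounded_kern|exact: density_integrable].
by apply/funext => y; rewrite mulrC.
Qed.

Lemma potential_ge0 q x : is_density q -> 0 <= potential q x.
Proof.
by move=> dq; apply: tint_ge0 => y Ty; rewrite mulr_ge0 ?kern_ge0// (density_ge0 dq).
Qed.

Lemma potential_le1 q x : is_density q -> potential q x <= 1.
Proof.
move=> dq; rewrite -(density_tint dq); apply: le_tint.
- exact: potential_integrable.
- exact: density_integrable.
- by move=> y Ty; rewrite ler_piMl ?kern_le1// (density_ge0 dq).
Qed.

Lemma potential_lipschitz q s t : is_density q ->
  `|potential q s - potential q t| <= 2 * pi * `|s - t|.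
Proof.
move=> dq; apply: tint_density_close => //; try exact: tbounded_kern.
move=> x _; rewrite (le_trans (kern_lipschitz _ _))//.
by rewrite (_ : s - x - (t - x) = s - t)//; ring.
Qed.

Lemma tbounded_potential q : is_density q -> tbounded (potential q).
Proof.
move=> dq; apply/tbounded_continuous/(@lipschitz_continuous _ (2 * pi)) => s t.
exact: potential_lipschitz.
Qed.

Definition kern_sum N (x y : R) : R := 2 / pi - 4 / pi * \sum_(i < N)
  sine_weight R i * (cos (i.+1%:R * phase x) * cos (i.+1%:R * phase y)
                   + sin (i.+1%:R * phase x) * sin (i.+1%:R * phase y)).

Definition kern_tol N : R := 4 / pi * (2 * sine_tol R N).

Lemma kern_expansion N x y : Tor x -> Tor y ->
  `|kern (x - y) - kern_sum N x y| <= kern_tol N.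
Proof.
rewrite /Defs.Tor /= !in_itv /= => /andP[x1 x2] /andP[y1 y2].
have p0 := pi_gt0 R.
have h : - (2 * pi) <= 2 * pi * (x - y) <= 2 * pi.
  have h0 : 0 < 2 * pi :> R by rewrite mulr_gt0.
  by apply/andP; split; [rewrite -mulrN1 ler_pM2l//; lra|
    rewrite -[leRHS]mulr1 ler_pM2l//; lra].
have -> : kern_sum N x y = 2 / pi - 4 / pi * sine_sum N (2 * pi * (x - y)).
  rewrite /kern_sum /sine_sum; congr (_ - _ * _); apply: eq_bigr => i _.
  by congr (_ * _); rewrite -cosB /phase; congr cos; ring.
exact: sine_expansion.
Qed.

Lemma tbounded_modes N (c s : nat -> R) :
  tbounded (fun x => 2 / pi - 4 / pi * \sum_(i < N) sine_weight R i *
     (c i * cos (i.+1%:R * phase x) + s i * sin (i.+1%:R * phase x))).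
Proof.
apply: tboundedD; first exact: tbounded_cst.
rewrite (_ : (fun x => - _) = fun x => (- (4 / pi)) * \sum_(i < N) sine_weight R i *
     (c i * cos (i.+1%:R * phase x) + s i * sin (i.+1%:R * phase x))); last first.
  by apply/funext => x; rewrite mulNr.
apply: tboundedM; first exact: tbounded_cst.
apply: tbounded_sum => i; apply: tboundedM; first exact: tbounded_cst.
by apply: tboundedD; apply: tboundedM;
  first [exact: tbounded_cst|exact: tbounded_cos|exact: tbounded_sin].
Qed.

Lemma tint_modes q N (c s : nat -> R) : is_density q ->
  tint (fun x => (2 / pi - 4 / pi * \sum_(i < N) sine_weight R i *
     (c i * cos (i.+1%:R * phase x) + s i * sin (i.+1%:R * phase x))) * q x) =
  2 / pi - 4 / pi * \sum_(i < N) sine_weight R i *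
     (c i * mode_cos q i.+1 + s i * mode_sin q i.+1).
Proof.
move=> dq; have iq := density_integrable dq.
have ic i : tintegrable (fun x => q x * cos (i%:R * phase x)).
  by apply: tintegrableM => //; exact: tbounded_cos.
have is_ i : tintegrable (fun x => q x * sin (i%:R * phase x)).
  by apply: tintegrableM => //; exact: tbounded_sin.
have it i : tintegrable (fun x => c i * (q x * cos (i.+1%:R * phase x)) +
    s i * (q x * sin (i.+1%:R * phase x))).
  by apply: tintegrableD; exact: tintegrableZl.
have itw : tintegrable (fun x => \sum_(i < N)
  sine_weight R i * (c i * (q x * cos (i.+1%:R * phase x)) +
    s i * (q x * sin (i.+1%:R * phase x)))).
  by apply: tintegrable_sum => i; exact: tintegrableZl.
rewrite (@eq_tint _ _ (fun x => 2 / pi * q x - 4 / pi * \sum_(i < N)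
  sine_weight R i * (c i * (q x * cos (i.+1%:R * phase x)) +
    s i * (q x * sin (i.+1%:R * phase x))))); last first.
  move=> x _; rewrite mulrBl -[4 / pi * _ * _]mulrA [in LHS]mulr_suml; congr (_ - _ * _).
  by apply: eq_bigr => i _; ring.
rewrite tintB; [|exact: tintegrableZl|exact: tintegrableZl].
rewrite tintZl// density_tint// mulr1 tintZl// tint_sum; last first.
  by move=> i; exact: tintegrableZl.
congr (_ - _ * _); apply: eq_bigr => i _.
rewrite tintZl// tintD; [|exact: tintegrableZl..].
by rewrite !tintZl.
Qed.

Lemma potential_expansion q N x : is_density q -> Tor x ->
  `|potential q x - (2 / pi - 4 / pi * \sum_(i < N) sine_weight R i *
     (mode_cos q i.+1 * cos (i.+1%:R * phase x) +
      mode_sin q i.+1 * sin (i.+1%:R * phase x)))| <= kern_tol N.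
Proof.
move=> dq Tx.
have -> : 2 / pi - 4 / pi * (\sum_(i < N) sine_weight R i *
     (mode_cos q i.+1 * cos (i.+1%:R * phase x) +
      mode_sin q i.+1 * sin (i.+1%:R * phase x))) =
  tint (fun y => kern_sum N x y * q y).
  rewrite /kern_sum (@tint_modes q N (fun i => cos (i.+1%:R * phase x))
    (fun i => sin (i.+1%:R * phase x)))//.
  by congr (_ - _ * _); apply: eq_bigr => i _; ring.
apply: tint_density_close => //; first exact: tbounded_kern.
  exact: (@tbounded_modes N (fun i => cos (i.+1%:R * phase x))
    (fun i => sin (i.+1%:R * phase x))).
by move=> y Ty; exact: kern_expansion.
Qed.

Definition jint p q : R := tint (fun x => potential p x * q x).

Definition mode_sum p q N : R := \sum_(i < N) sine_weight R i *
  (mode_cos p i.+1 * mode_cos q i.+1 + mode_sin p i.+1 * mode_sin q i.+1).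

Lemma jint_expansion p q N : is_density p -> is_density q ->
  `|jint p q - (2 / pi - 4 / pi * mode_sum p q N)| <= kern_tol N.
Proof.
move=> dp dq; rewrite /mode_sum.
rewrite -(@tint_modes q N (fun i => mode_cos p i.+1) (fun i => mode_sin p i.+1))//.
apply: tint_density_close => //; first exact: tbounded_potential.
  exact: (@tbounded_modes N (fun i => mode_cos p i.+1) (fun i => mode_sin p i.+1)).
by move=> x Tx; exact: potential_expansion.
Qed.

Lemma potential_density_integrable p q : is_density p -> is_density q ->
  tintegrable (fun x => potential p x * q x).
Proof.
move=> dp dq; rewrite (_ : (fun x => _) = fun x => q x * potential p x).
  by apply: tintegrableM; [exact: tbounded_potential|exact: density_integrable].
by apply/funext => x; rewrite mulrC.
Qed.

Lemma jint_ge0 p q : is_density p -> is_density q -> 0 <= jint p q.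
Proof.
move=> dp dq; apply: tint_ge0 => x Tx.
by rewrite mulr_ge0 ?potential_ge0// (density_ge0 dq).
Qed.

(** The passage [N -> oo], used for equalities too by applying it in both directions. Starting at
    [N = 2] serves the estimates in which the first two modes must be present. *)
Lemma kern_tol_lim (x y c : R) : 0 <= c ->
  (forall N, (2 <= N)%N -> x <= y + c * kern_tol N) -> x <= y.
Proof.
move=> c0 H; rewrite leNgt; apply/negP => yx.
have p0 := pi_gt0 R; have p2 := pi_ge2 R.
set M := Num.truncn (4 * c / (x - y)).
have xy : 0 < x - y by rewrite subr_gt0.
have hM : 4 * c / (x - y) < M.+1%:R by rewrite real_truncnS_gt// num_real.
have hM' : 4 * c < M.+1%:R * (x - y) by rewrite -ltr_pdivrMr.
have := H M.+2 isT.
have -> : kern_tol M.+2 = 4 / (pi * (2 * M.+2%:R + 1)).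
  rewrite /kern_tol /sine_tol; have := odd_nat_neq0 R M.+2.
  have : pi != 0 :> R by rewrite gt_eqF.
  by move: (pi : R) (M.+2%:R : R) => P m P0 h; field; rewrite h P0.
have M0 : 0 <= M.+1%:R :> R by [].
have hd : M.+1%:R <= pi * (2 * M.+2%:R + 1) :> R.
  rewrite -[M.+2%:R]natr1; apply: le_trans (_ : 1 * (2 * (M.+1%:R + 1) + 1) <= _).
    by rewrite mul1r; lra.
  by rewrite ler_wpM2r//; lra.
have hd0 : 0 < pi * (2 * M.+2%:R + 1) :> R by rewrite mulr_gt0// ltr_wpDl// mulr_ge0.
rewrite -lerBlDl mulrA ler_pdivlMr// => h.
have : M.+1%:R * (x - y) <= (x - y) * (pi * (2 * M.+2%:R + 1)).
  by rewrite mulrC ler_pM2l.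
by rewrite leNgt => /negP; apply; rewrite (le_lt_trans h)// mulrC.
Qed.

Lemma mode_u k : mode_cos (@q_u R) k.+1 = 0 /\ mode_sin (@q_u R) k.+1 = 0.
Proof.
rewrite /mode_cos /mode_sin /q_u; split.
- transitivity (((k.+1 == 0)%N%:R) : R) => //; rewrite -(@tint_cos R k.+1 0).
  by apply: eq_tint => x _; rewrite mul1r subr0.
- rewrite -(@tint_sin R k.+1 0).
  by apply: eq_tint => x _; rewrite mul1r subr0.
Qed.

Lemma jint_u : jint (@q_u R) (@q_u R) = 2 / pi.
Proof.
have du := density_q_u.
have ms N : mode_sum (@q_u R) (@q_u R) N = 0.
  by rewrite /mode_sum big1// => i _; have [-> ->] := mode_u i; rewrite !mul0r addr0 mulr0.
have H N := @jint_expansion _ _ N du du.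
apply/eqP; rewrite eq_le; apply/andP; split; apply: (@kern_tol_lim _ _ 1) => // N _;
by have := H N; rewrite ms mulr0 subr0 mul1r ler_norml => /andP[]; lra.
Qed.

Lemma interactionE q : is_density q -> interaction (@W_DO R) q = (- jint q q)%:E.
Proof.
move=> dq; rewrite /interaction.
have iq := potential_density_integrable dq dq.
rewrite (_ : - jint q q = tint (fun x => (-1) * (potential q x * q x))); last first.
  by rewrite tintZl// mulN1r.
rewrite -tintE; last exact: tintegrableZl.
apply: eq_integral => x _.
have ip := potential_integrable x dq.
rewrite (_ : -1 * _ = tint (fun y => (- q x) * (kern (x - y) * q y))); last first.
  by rewrite tintZl// /potential; ring.
rewrite -tintE; last exact: tintegrableZl.
by apply: eq_integral => y _; congr (_%:E); rewrite /W_DO /kern; ring.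
Qed.

(** * Entropy and free energy of a density *)

Definition ent q : R := tint (fun x => q x * ln (q x)).

(* Young's inequality for the convex conjugate pair [r ln r - r], [e^s]. *)
Lemma entropy_young (r s : R) : 0 <= r -> r * s + r - expR s <= r * ln r.
Proof.
rewrite le_eqVlt => /predU1P[<-|r0].
  by rewrite !mul0r addr0 sub0r oppr_le0 expR_ge0.
have := expR_ge1Dx (s - ln r); rewrite expRB lnK ?posrE// ler_pdivlMr//; lra.
Qed.

Lemma measurable_entropy q : is_density q ->
  measurable_fun Tor (fun x => q x * ln (q x)).
Proof.
move=> [mq _]; apply: measurable_funM => //.
by apply: measurableT_comp => //; exact: measurable_ln.
Qed.

(** Since [r ln r >= -1] and the torus has finite measure, the negative part is integrable, and
    divergence can only be to [+oo]. Minimisation thus reduces to real-valued energies. *)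
Lemma entropy_dichotomy q : is_density q ->
  tintegrable (fun x => q x * ln (q x)) \/ entropy q = +oo%E.
Proof.
move=> dq; have mf := measurable_entropy dq.
have lb x : Tor x -> -1 <= q x * ln (q x).
  move=> Tx; have := @entropy_young (q x) 0 (density_ge0 dq Tx).
  by rewrite mulr0 add0r expR0; have := density_ge0 dq Tx; lra.
rewrite /entropy /tintegrable; set F := fun x => (_)%:E.
have mF : measurable_fun Tor F by exact/measurable_EFinP.
have mT := @measurable_Tor R.
have mFp : measurable_fun Tor F^\+%E by exact: measurable_funepos.
have mFn : measurable_fun Tor F^\-%E by exact: measurable_funeneg.
have negF : (\int[mu]_(x in Tor) F^\-%E x < +oo)%E.
  apply: (@le_lt_trans _ _ (\int[mu]_(x in Tor) (cst (1 : R) x)%:E)%E); last first.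
    by rewrite (tintE (tintegrable_tbounded (tbounded_cst 1))) ltry.
  apply: ge0_le_integral => //; first exact/measurable_EFinP/measurable_cst.
  by move=> x Tx; rewrite funenegE ge_max /= !lee_fin ler01 andbT lerNl lb.
have posneg : (0 <= \int[mu]_(x in Tor) F^\-%E x)%E by exact: integral_ge0.
have [posF|] := ltP (\int[mu]_(x in Tor) F^\+%E x)%E +oo%E.
  left; apply/integrableP; split => //.
  rewrite (_ : (\int[mu]_(x in Tor) _)%E =
    (\int[mu]_(x in Tor) (F^\+%E x + F^\-%E x))%E); last first.
    apply: eq_integral => x _; have /(congr1 (fun f => f x)) := fune_abse F; exact.
  by rewrite ge0_integralD//; exact: lte_add_pinfty.
rewrite leye_eq => /eqP posF; right.
rewrite integralE posF addye//.
by move: negF posneg; case: (\int[mu]_(x in Tor) _)%E.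
Qed.

Lemma free_energyE (K : R) q : is_density q ->
  tintegrable (fun x => q x * ln (q x)) ->
  free_energy (@W_DO R) K q = (ent q + K * jint q q)%:E.
Proof.
move=> dq iq; rewrite /free_energy interactionE// /entropy tintE//.
by rewrite -EFinM -EFinB mulrN opprK.
Qed.

Lemma free_energy_infty (K : R) q : is_density q -> entropy q = +oo%E ->
  free_energy (@W_DO R) K q = +oo%E.
Proof. by move=> dq eq; rewrite /free_energy interactionE// eq -EFinM. Qed.

Lemma ent_u : ent (@q_u R) = 0 /\ tintegrable (fun x => q_u x * ln (@q_u R x)).
Proof.
rewrite /ent /q_u; split.
  by rewrite -[RHS](@tint_cst R 0); apply: eq_tint => x _; rewrite ln1 mulr0.
exact/tintegrable_tbounded/tbounded_cst.
Qed.

Lemma free_energy_u (K : R) :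
  free_energy (@W_DO R) K (@q_u R) = (K * (2 / pi))%:E.
Proof.
have [e0 ie] := ent_u.
by rewrite free_energyE ?e0 ?add0r ?jint_u//; exact: density_q_u.
Qed.

End densities.

(** * The entropy deficit *)

Section deficit.
Variable R : realType.
Local Notation mu := (@lebesgue_measure R).
Local Notation Tor := (@Defs.Tor R).
Implicit Types (q : R -> R) (N k n : nat).

Definition has_entropy q : Prop := tintegrable (fun x => q x * ln (q x)).

(** Young's inequality integrated. The term [1 - int e^g] replaces the usual [- ln int e^g]; a shift
    of [g] by a constant recovers the logarithm. *)
Lemma gibbs_variational q (g : R -> R) : is_density q -> has_entropy q ->
  tbounded g -> tint (fun x => q x * g x) + 1 - tint (fun x => expR (g x)) <= ent q.
Proof.
move=> dq eq bg; have iq := density_integrable dq.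
have iqg : tintegrable (fun x => q x * g x) by exact: tintegrableM.
have ie : tintegrable (fun x => expR (g x)).
  exact/tintegrable_tbounded/tbounded_expR.
rewrite -(density_tint dq) -tintD// -tintB//; last exact: tintegrableD.
apply: le_tint => //; first by apply: tintegrableB => //; exact: tintegrableD.
by move=> x Tx; apply: entropy_young; exact: density_ge0 Tx.
Qed.

Lemma ent_ge0 q : is_density q -> has_entropy q -> 0 <= ent q.
Proof.
move=> dq eq; have := gibbs_variational dq eq (tbounded_cst 0).
rewrite (_ : tint _ = 0) ?add0r ?expR0 ?tint_cst ?subrr//.
by rewrite -[RHS](tint_cst 0); apply: eq_tint => x _; rewrite mulr0.
Qed.

Definition mode_energy q k : R := mode_cos q k ^+ 2 + mode_sin q k ^+ 2.

Lemma mode_energy_ge0 q k : 0 <= mode_energy q k.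
Proof. by rewrite addr_ge0 ?sqr_ge0. Qed.

(** This is [|c_2 - c_1^2|^2 / 4], the value of the Lebedev-Milin deficit at the coefficients tested
    in [entropy_modes]. *)
Definition mode_defect q : R :=
  ((mode_cos q 2%N - (mode_cos q 1%N ^+ 2 - mode_sin q 1%N ^+ 2)) ^+ 2 +
   (mode_sin q 2%N - 2 * mode_cos q 1%N * mode_sin q 1%N) ^+ 2) / 4.

Lemma mode_defect_ge0 q : 0 <= mode_defect q.
Proof. by rewrite divr_ge0// addr_ge0 ?sqr_ge0. Qed.

(* Lebedev-Milin is dual to the logarithmic Hardy-Littlewood-Sobolev inequality:
   test the Gibbs principle with the potential whose coefficients are
   [conj (c_k) / k]. *)
Lemma entropy_modes q N : is_density q -> has_entropy q -> (2 <= N)%N ->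
  \sum_(i < N) mode_energy q i.+1 / i.+1%:R +
  mode_defect q * expR (- \sum_(i < N) mode_energy q i.+1 / i.+1%:R) <= ent q.
Proof.
move=> dq eq N2; have iq := density_integrable dq.
set A := \sum_(i < N) _.
pose g k : R := if (k <= N)%N then mode_cos q k / k%:R else 0.
pose d k : R := if (k <= N)%N then - (mode_sin q k / k%:R) else 0.
have g0 : g 0%N = 0 by rewrite /g /= invr0 mulr0.
have d0 : d 0%N = 0 by rewrite /d /= invr0 mulr0 oppr0.
have gN k : (N < k)%N -> g k = 0 by rewrite /g ltnNge => /negbTE ->.
have dN k : (N < k)%N -> d k = 0 by rewrite /d ltnNge => /negbTE ->.
have AE : \sum_(k < N.+1) k%:R * (g k ^+ 2 + d k ^+ 2) = A.
  rewrite big_ord_recl /= mul0r add0r; apply: eq_bigr => i _.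
  rewrite /bump /= add1n /g /d ltn_ord /mode_energy.
  have : i.+1%:R != 0 :> R by rewrite pnatr_eq0.
  by move: (i.+1%:R : R) => m m0; field; rewrite m0.
have := lebedev_milin N2 g0 d0 gN dN; rewrite AE.
have -> : (g 2%N - (g 1%N ^+ 2 - d 1%N ^+ 2) / 2) ^+ 2 + (d 2%N - g 1%N * d 1%N) ^+ 2
  = mode_defect q.
  by rewrite /g /d N2 (ltnW N2) /mode_defect; field.
set T := tint _ => LM.
have bt := tbounded_trig_poly g d N.
have b2t : tbounded (fun x => 2 * trig_poly g d N x).
  by apply: tboundedM => //; exact: tbounded_cst.
(* Subtracting [A] brings the integral of the exponential below [1 - mode_defect q * expR (- A)],
   while the linear term becomes [2 A - A]. *)
have bG : tbounded (fun x => 2 * trig_poly g d N x - A).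
  by apply: tboundedD => //; exact: tbounded_cst.
have := gibbs_variational dq eq bG.
have -> : tint (fun x => expR (2 * trig_poly g d N x - A)) = T * expR (- A).
  rewrite -tintZr; first by apply: eq_tint => x _; rewrite expRD.
  exact/tintegrable_tbounded/tbounded_expR.
have ic i : tintegrable (fun x => q x * cos (i%:R * phase x)).
  by apply: tintegrableM => //; exact: tbounded_cos.
have is_ i : tintegrable (fun x => q x * sin (i%:R * phase x)).
  by apply: tintegrableM => //; exact: tbounded_sin.
have it k : tintegrable (fun x => g k * (q x * cos (k%:R * phase x)) -
   d k * (q x * sin (k%:R * phase x))).
  by apply: tintegrableB; exact: tintegrableZl.
have -> : tint (fun x => q x * (2 * trig_poly g d N x - A)) = A.
  rewrite (@eq_tint _ _ (fun x => 2 * (\sum_(k < N.+1)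
     (g k * (q x * cos (k%:R * phase x)) - d k * (q x * sin (k%:R * phase x))))
     - A * q x)); last first.
    move=> x _; rewrite mulrBr mulrCA [A * _]mulrC; congr (_ * _ - _).
    by rewrite /trig_poly mulr_sumr; apply: eq_bigr => k _; ring.
  have is2 : tintegrable (fun x => \sum_(k < N.+1)
     (g k * (q x * cos (k%:R * phase x)) - d k * (q x * sin (k%:R * phase x)))).
    exact: (@tintegrable_sum _ _ _ (fun (k : 'I_N.+1) x =>
      g k * (q x * cos (k%:R * phase x)) - d k * (q x * sin (k%:R * phase x)))).
  have tA : tint (fun x => \sum_(k < N.+1)
     (g k * (q x * cos (k%:R * phase x)) - d k * (q x * sin (k%:R * phase x)))) = A.
    rewrite tint_sum// -AE; apply: eq_bigr => k _.
    rewrite tintB; [|exact: tintegrableZl|exact: tintegrableZl].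
    rewrite !tintZl// -/(mode_cos q k) -/(mode_sin q k).
    case: k => -[_|k] /=; first by rewrite g0 d0; ring.
    rewrite ltnS => kN; rewrite /g /d kN.
    have : k.+1%:R != 0 :> R by rewrite pnatr_eq0.
    by move: (k.+1%:R : R) => m m0; field; rewrite m0.
  rewrite tintB; [|exact: tintegrableZl|exact: tintegrableZl].
  by rewrite (tintZl 2 is2) (tintZl A iq) tA density_tint//; ring.
apply: le_trans.
have : T * expR (- A) <= (expR A - mode_defect q) * expR (- A).
  by rewrite ler_pM2r// expR_gt0.
rewrite mulrBl expRxMexpNx_1; lra.
Qed.

(* By how much the interaction energy of [q] at the critical coupling lies below that of
   [q_u]. *)
Definition gap q : R := 3 * pi / 4 * (2 / pi - jint q q).

Lemma gap_expansion q N : is_density q ->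
  `|gap q - 3 * mode_sum q q N| <= 3 * pi / 4 * kern_tol R N.
Proof.
move=> dq; have p0 := pi_gt0 R; have pn0 : pi != 0 :> R by rewrite gt_eqF.
have K0 : 0 <= 3 * pi / 4 :> R by rewrite divr_ge0// mulr_ge0// ltW.
have -> : gap q - 3 * mode_sum q q N =
  (3 * pi / 4) * - (jint q q - (2 / pi - 4 / pi * mode_sum q q N)).
  by rewrite /gap; move: (pi : R) pn0 => p pn0; field.
by rewrite normrM normrN ger0_norm// ler_wpM2l//; exact: jint_expansion.
Qed.

Lemma mode_sumE q n : 3 * mode_sum q q n.+1 = mode_energy q 1 +
  3 * \sum_(i < n) sine_weight R i.+1 * mode_energy q i.+2.
Proof.
rewrite /mode_sum big_ord_recl mulrDr; congr (_ + _ * _).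
  by rewrite /sine_weight /mode_energy /= !expr2; field.
Qed.

Lemma pi_tol_ge0 : 0 <= 3 * pi / 4 :> R.
Proof. by rewrite divr_ge0// mulr_ge0// pi_ge0. Qed.

(** For [l >= 2] one has [(5 / 2) * 3 / (4 l^2 - 1) <= 1 / l], with equality at [l = 2]. The higher
    modes thus enter the entropy bound at least [5 / 2] times as strongly as they enter [gap q], and
    [3 / 2] of that survives subtraction. The exponent [- ent q] replaces one that depends on
    [N]. *)
Lemma entropy_deficit q : is_density q -> has_entropy q ->
  3 / 2 * (gap q - mode_energy q 1) + mode_defect q * expR (- ent q) <=
  ent q - gap q.
Proof.
move=> dq eq; have d0 := mode_defect_ge0 q.
suff : 5 / 2 * gap q - 3 / 2 * mode_energy q 1 + mode_defect q * expR (- ent q) <=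
  ent q by lra.
apply: (@kern_tol_lim R _ _ (5 / 2 * (3 * pi / 4))).
  by rewrite mulr_ge0// pi_tol_ge0.
case=> [|[|n]]// N2.
have := gap_expansion n.+2 dq; rewrite mode_sumE ler_norml => /andP[_].
have := entropy_modes dq eq N2.
set A := \sum_(i < n.+2) _; set s := \sum_(i < n.+1) _ => hA hg.
have As : mode_energy q 1 + 15 / 2 * s <= A.
  rewrite /A big_ord_recl /= divr1 lerD2l /s mulr_sumr; apply: ler_sum => i _.
  rewrite /bump /= add1n mulrA [leRHS]mulrC ler_wpM2r ?mode_energy_ge0//.
  rewrite /sine_weight ler_pdivrMr; last first.
    by rewrite -invr_gt0; exact: sine_weight_gt0.
  have h : 2 <= i.+2%:R :> R by rewrite ler_nat.
  by rewrite ler_pdivlMl; [nra|lra].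
have A0 : mode_defect q * expR (- ent q) <= mode_defect q * expR (- A).
  rewrite ler_wpM2l// ler_expR lerN2 (le_trans _ hA)// lerDl.
  by rewrite mulr_ge0// expR_ge0.
lra.
Qed.

(** The mode [l = 2] has weight [1 / 15], hence [3 / 15]; the later modes contribute
    nonnegatively. *)
Lemma mode_energy2_le q : is_density q ->
  mode_energy q 2 / 5 <= gap q - mode_energy q 1.
Proof.
move=> dq; apply: (@kern_tol_lim R _ _ (3 * pi / 4)); first exact: pi_tol_ge0.
case=> [|[|n]]// _.
have := gap_expansion n.+2 dq; rewrite mode_sumE ler_norml => /andP[+ _].
rewrite big_ord_recl /=.
have -> : sine_weight R 1 = 15^-1 by rewrite /sine_weight; congr (_^-1); ring.
have : 0 <= \sum_(i < n) sine_weight R (lift ord0 i).+1 * mode_energy q (lift ord0 i).+2.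
  by rewrite sumr_ge0// => i _; rewrite mulr_ge0 ?mode_energy_ge0// ltW// sine_weight_gt0.
set s := \sum_(i < n) _; set c1 := mode_energy q 1; set c2 := mode_energy q 2; lra.
Qed.

(** From [|c_1|^4 <= 2 |c_2|^2 + 2 |c_2 - c_1^2|^2]: the degenerate first mode is controlled through
    the second. *)
Lemma mode_energy1_sqr_le q : is_density q ->
  mode_energy q 1 ^+ 2 <= 10 * (gap q - mode_energy q 1) + 8 * mode_defect q.
Proof.
move=> dq; have := mode_energy2_le dq; move: (gap q) => G.
set y := G - _ => h.
have : mode_energy q 1 ^+ 2 <= 2 * mode_energy q 2 + 8 * mode_defect q.
  rewrite /mode_energy /mode_defect.
  set a := mode_cos q 1; set b := mode_sin q 1.
  set c := mode_cos q 2; set d := mode_sin q 2.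
  have := sqr_ge0 (2 * c - (a ^+ 2 - b ^+ 2)).
  have := sqr_ge0 (2 * d - 2 * a * b).
  by move=> h1 h2; rewrite -subr_ge0 (le_trans (addr_ge0 h1 h2))// le_eqVlt;
    apply/orP; left; apply/eqP; field.
lra.
Qed.

(** By [entropy_deficit], [ent q - gap q] dominates [3 / 2] times the energy of the higher modes and
    [expR (- ent q)] times the defect. Inserted into the quartic bound, this gives [10 * (2 / 3)]
    and [8 * expR (ent q)]. *)
Lemma gap_le_ent q : is_density q -> has_entropy q ->
  [/\ 0 <= gap q - mode_energy q 1, gap q <= ent q &
  mode_energy q 1 ^+ 2 <= (20 / 3 + 8 * expR (ent q)) * (ent q - gap q)].
Proof.
move=> dq eq; have h1 := entropy_deficit dq eq.
have h2 := mode_energy2_le dq; have h3 := mode_energy1_sqr_le dq.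
have h4 := mode_energy_ge0 q 2; have h5 := mode_defect_ge0 q.
have y0 : 0 <= gap q - mode_energy q 1.
  by rewrite (le_trans _ h2)// divr_ge0.
have h6 : 0 <= mode_defect q * expR (- ent q) by rewrite mulr_ge0// expR_ge0.
split => //; first by rewrite -subr_ge0 (le_trans _ h1)// addr_ge0// mulr_ge0.
have : mode_defect q <= expR (ent q) * (ent q - gap q).
  rewrite -ler_pdivrMl ?expR_gt0// -expRN mulrC (le_trans _ h1)// lerDr mulr_ge0//.
have : gap q - mode_energy q 1 <= 2 / 3 * (ent q - gap q) by lra.
set e := expR _; set D := ent q - gap q.
have -> : (20 / 3 + 8 * e) * D = 20 / 3 * D + 8 * (e * D) by ring.
by move: (e * D) => eD; lra.
Qed.

(** * Entropy, distance to the uniform density, and minimizers up to the threshold *)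

Lemma expR_quadratic_le (s : R) : - 2^-1 <= s <= 2^-1 -> expR s <= 1 + s + 2 * s ^+ 2.
Proof.
move=> hs; have := expR_ge1Dx (- s); rewrite expRN => h.
have s1 : 0 < 1 - s by lra.
have : expR s <= (1 - s)^-1.
  by rewrite -[expR s]invrK lef_pV2 ?posrE ?invr_gt0 ?expR_gt0.
move/le_trans; apply; rewrite -[leLHS]mul1r ler_pdivrMr//; nra.
Qed.

(* The choice [eta ~ sqrt (ent q)] recovers Pinsker's inequality up to a constant. *)
Lemma entropy_L1 q (eta : R) : is_density q -> has_entropy q ->
  0 < eta <= 2^-1 -> tint (fun x => `|q x - 1|) <= 2 * eta + ent q / eta.
Proof.
move=> dq eq /andP[e0 e1]; have iq := density_integrable dq.
have ic (c : R) : tintegrable (fun=> c) by exact/tintegrable_tbounded/tbounded_cst.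
have iB : tintegrable (fun x => q x - 1) by exact: tintegrableB.
have iA : tintegrable (fun x => `|q x - 1|) by exact: tintegrable_norm.
have iL : tintegrable (fun x => eta * `|q x - 1| - 2 * eta ^+ 2).
  by apply: tintegrableB => //; exact: tintegrableZl.
have : tint (fun x => eta * `|q x - 1| - 2 * eta ^+ 2) <= ent q.
  have -> : ent q = tint (fun x => q x * ln (q x) - (q x - 1)).
    have E : tint (fun x => q x - 1) = 0.
      by rewrite tintB// tint_cst density_tint// subrr.
    by rewrite tintB// E subr0.
  apply: le_tint => //; first exact: tintegrableB.
  move=> x Tx; have q0 := density_ge0 dq Tx.
  (* Young's inequality is used at [eta] or [- eta], according to the sign of [q x - 1]. *)
  have [q1|q1] := leP 1 (q x).
    rewrite ger0_norm ?subr_ge0//.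
    have := entropy_young eta q0.
    have := @expR_quadratic_le eta; lra.
  rewrite ltr0_norm ?subr_lt0//.
  have := entropy_young (- eta) q0.
  have := @expR_quadratic_le (- eta); rewrite sqrrN; lra.
rewrite tintB ?tintZl ?tint_cst//; last exact: tintegrableZl.
set L := tint _ => h.
have -> : 2 * eta + ent q / eta = (ent q + 2 * eta ^+ 2) / eta.
  by field; rewrite gt_eqF.
by rewrite ler_pdivlMr// mulrC; lra.
Qed.

Lemma dens_eq_u q : is_density q -> has_entropy q -> ent q <= 0 ->
  dens_eq q (@q_u R).
Proof.
move=> dq eq e0; have iq := density_integrable dq.
have ic (c : R) : tintegrable (fun=> c) by exact/tintegrable_tbounded/tbounded_cst.
have iB : tintegrable (fun x => q x - 1) by exact: tintegrableB.
have L0 : tint (fun x => `|q x - 1|) = 0.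
  apply/eqP; rewrite eq_le; apply/andP; split; last by apply: tint_ge0 => x _.
  apply/ler_addgt0Pr => e epos; rewrite add0r.
  have h : 0 < Num.min (e / 2) 2^-1 <= 2^-1.
    by rewrite lt_min ge_min lexx orbT invr_gt0 divr_gt0//= ltr0n.
  rewrite (le_trans (entropy_L1 dq eq h))//.
  have m : Num.min (e / 2) 2^-1 <= e / 2 by rewrite ge_min lexx.
  case/andP: h => h _.
  have : ent q / Num.min (e / 2) 2^-1 <= 0 by rewrite pmulr_lle0// invr_gt0.
  lra.
have iA := tintegrable_norm iB.
have mf : measurable_fun Tor (EFin \o (fun x => q x - 1)).
  by apply/measurable_EFinP; exact: tintegrable_measurable iB.
have := (ae_eq_integral_abs mu (@measurable_Tor R) mf).1.
have -> : (\int[mu]_(x in Tor) `|(EFin \o (fun x => q x - 1)%R) x|)%E = 0%E.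
  transitivity (tint (fun x => `|q x - 1|))%:E; last by rewrite L0.
  by rewrite -tintE.
move=> /(_ erefl); apply: filterS => x H Tx.
by have := H Tx; move=> /eqP; rewrite /= eqe subr_eq0 => /eqP.
Qed.

Lemma minimizer_entropy (K : R) q : is_global_minimizer (@W_DO R) K q ->
  [/\ is_density q, has_entropy q & ent q <= K * (2 / pi - jint q q)].
Proof.
move=> [dq Hq]; have := Hq _ (density_q_u R); rewrite free_energy_u.
have [eq|eq] := entropy_dichotomy dq; last by rewrite free_energy_infty.
rewrite free_energyE// lee_fin => h; split => //; rewrite mulrBr; lra.
Qed.

Lemma gapE (K : R) q : K * (2 / pi - jint q q) = K / (3 * pi / 4) * gap q.
Proof.
rewrite /gap; have pn0 : pi != 0 :> R by rewrite gt_eqF// pi_gt0.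
by move: (pi : R) (jint q q) pn0 => p j pn0; field; rewrite pn0.
Qed.

Lemma gap_ge0 q : is_density q -> 0 <= gap q.
Proof.
move=> dq; have := mode_energy2_le dq; have := mode_energy_ge0 q 1.
have := mode_energy_ge0 q 2; lra.
Qed.

Lemma Kc_gt0 : 0 < 3 * pi / 4 :> R.
Proof. by rewrite divr_gt0// mulr_gt0// pi_gt0. Qed.

Lemma gap_ratio (K : R) q : is_density q -> 0 <= K <= 3 * pi / 4 ->
  K * (2 / pi - jint q q) <= gap q.
Proof.
move=> dq /andP[K0 KK]; rewrite gapE ler_piMl ?gap_ge0//.
by rewrite ler_pdivrMr ?mul1r// Kc_gt0.
Qed.

Lemma minimizer_u (K : R) : 0 <= K <= 3 * pi / 4 ->
  is_global_minimizer (@W_DO R) K (@q_u R).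
Proof.
move=> hK; split; first exact: density_q_u.
move=> p dp; rewrite free_energy_u.
have [ep|ep] := entropy_dichotomy dp; last by rewrite free_energy_infty// leey.
rewrite free_energyE// lee_fin.
have [_ + _] := gap_le_ent dp ep; have := gap_ratio dp hK; rewrite mulrBr; lra.
Qed.

(** Comparison with [q_u] forces [ent q = gap q]. The quartic bound then kills the first mode, and
    only after that does [entropy_deficit] yield [gap q <= 0] and so [ent q <= 0]. *)
Lemma minimizer_unique (K : R) q : 0 <= K <= 3 * pi / 4 ->
  is_global_minimizer (@W_DO R) K q -> dens_eq q (@q_u R).
Proof.
move=> hK /minimizer_entropy[dq eq h]; apply: dens_eq_u => //.
have [y0 ge c1] := gap_le_ent dq eq; have gr := gap_ratio dq hK.
have E : ent q - gap q = 0 by lra.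
have : mode_energy q 1 ^+ 2 <= 0 by rewrite (le_trans c1)// E mulr0.
rewrite real_exprn_even_le0 ?num_real//= => /eqP c10.
have := entropy_deficit dq eq; rewrite c10 E.
have : 0 <= mode_defect q * expR (- ent q).
  by rewrite mulr_ge0 ?expR_ge0 ?mode_defect_ge0.
lra.
Qed.

End deficit.

(** * Existence and nontriviality of minimizers *)

Section existence.
Variable R : realType.
Local Notation mu := (@lebesgue_measure R).
Local Notation Tor := (@Defs.Tor R).
Implicit Types (p q : R -> R) (N n : nat).

(** This is [jint (p - q) (p - q) <= 0] expanded: the kernel has nonpositive coefficients at all
    nonzero modes, and the constant mode cancels because both masses are [1]. The tolerance is
    [1 + 1 + 2]. *)
Lemma jint_convex p q : is_density p -> is_density q ->
  jint p p + jint q q <= 2 * jint q p.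
Proof.
move=> dp dq; apply: (@kern_tol_lim R _ _ 4) => // N _.
have := jint_expansion N dp dp; rewrite ler_norml => /andP[_ h1].
have := jint_expansion N dq dq; rewrite ler_norml => /andP[_ h2].
have := jint_expansion N dq dp; rewrite ler_norml => /andP[h3 _].
have ms : 0 <= mode_sum p p N + mode_sum q q N - 2 * mode_sum q p N.
  rewrite /mode_sum mulr_sumr -big_split -sumrB sumr_ge0// => i _ /=.
  rewrite (_ : _ - _ = sine_weight R i *
    ((mode_cos p i.+1 - mode_cos q i.+1) ^+ 2 +
     (mode_sin p i.+1 - mode_sin q i.+1) ^+ 2)); last by ring.
  by rewrite mulr_ge0 ?(ltW (sine_weight_gt0 R i))// addr_ge0 ?sqr_ge0.
have : 0 <= 4 / pi * (mode_sum p p N + mode_sum q q N - 2 * mode_sum q p N).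
  by rewrite mulr_ge0// divr_ge0// pi_ge0.
rewrite mulrBr mulrDr (mulrCA _ 2).
move: (4 / pi * _) (4 / pi * _) (4 / pi * _) h1 h2 h3 => a b c; lra.
Qed.

(** Entropy plus a linear term has the explicit minimizer [e^(- 2 K u) / Z]: with [g - ln Z] as test
    function, the Gibbs principle is an equality at this density. The factor [2] comes from
    linearising the quadratic energy. *)
Lemma gibbs_state (K : R) (u : R -> R) : tbounded u ->
  exists p, [/\ is_density p, has_entropy p & forall q, is_density q -> has_entropy q ->
    ent p + 2 * K * tint (fun x => u x * p x) <=
    ent q + 2 * K * tint (fun x => u x * q x)].
Proof.
move=> bu; pose g x := (- (2 * K)) * u x.
have bg : tbounded g by apply: tboundedM => //; exact: tbounded_cst.
have be : tbounded (fun x => expR (g x)) by exact: tbounded_expR.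
have ie := tintegrable_tbounded be.
pose Z := tint (fun x => expR (g x)).
have Z0 : 0 < Z.
  have [_ [M HM]] := bg.
  apply: (@lt_le_trans _ _ (tint (fun=> expR (- M)))); first by rewrite tint_cst expR_gt0.
  apply: le_tint => //; first exact/tintegrable_tbounded/tbounded_cst.
  by move=> x /HM; rewrite ler_expR ler_norml => /andP[].
pose p x := expR (g x) * Z^-1.
have bp : tbounded p by apply: tboundedM => //; exact: tbounded_cst.
have p1 : tint p = 1 by rewrite /p tintZr// -/Z mulfV// gt_eqF.
have dp : is_density p.
  apply: is_densityP => //; [by case: bp| |exact: tintegrable_tbounded].
  by move=> x _; rewrite mulr_ge0 ?expR_ge0// invr_ge0 ltW.
have lnp x : ln (p x) = g x - ln Z.
  by rewrite /p ln_div ?posrE ?expR_gt0// expRK.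
have bl : tbounded (fun x => g x - ln Z) by apply: tboundedD => //; exact: tbounded_cst.
have ep : has_entropy p.
  rewrite /has_entropy (_ : (fun x => _) = fun x => p x * (g x - ln Z)).
    by apply/tintegrable_tbounded/tboundedM.
  by apply/funext => x; rewrite lnp.
have pot q : is_density q -> tint (fun x => q x * (g x - ln Z)) =
    - (2 * K * tint (fun x => u x * q x)) - ln Z.
  move=> dq; have iq := density_integrable dq.
  have iuq : tintegrable (fun x => u x * q x).
    rewrite (_ : (fun x => _) = fun x => q x * u x); first exact: tintegrableM.
    by apply/funext => x; rewrite mulrC.
  rewrite (@eq_tint _ _ (fun x => (- (2 * K)) * (u x * q x) - ln Z * q x)); last first.
    by move=> x _; rewrite /g; ring.
  rewrite tintB; [|exact: tintegrableZl|exact: tintegrableZl].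
  by rewrite (tintZl _ iuq) (tintZl _ iq) (density_tint dq) mulr1 mulNr.
exists p; split => // q dq eq.
have := gibbs_variational dq eq bl; rewrite pot//.
have -> : tint (fun x => expR (g x - ln Z)) = 1.
  rewrite -p1; apply: eq_tint => x _; rewrite expRB lnK//.
have -> : ent p = - (2 * K * tint (fun x => u x * p x)) - ln Z.
  by rewrite -pot//; apply: eq_tint => x _; rewrite lnp.
lra.
Qed.

(* Majorisation by the linearised interaction: [- jint] is positive
   semidefinite on differences of densities. *)
Lemma gibbs_state_energy (K : R) (u : R -> R) (e : R) p q : 0 <= K ->
  tbounded u -> is_density p -> is_density q ->
  ent p + 2 * K * tint (fun x => u x * p x) <=
    ent q + 2 * K * tint (fun x => u x * q x) ->
  (forall x, Tor x -> `|potential q x - u x| <= e) ->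
  ent p + K * jint p p <= ent q + K * jint q q + 4 * K * e.
Proof.
move=> K0 bu dp dq h He; have conv := jint_convex dp dq.
have bq := tbounded_potential dq.
(* Exchanging [u] and [potential q] under [p], and again under [q], costs [2 K e] each time. *)
have := tint_density_close dp bq bu He; rewrite -/(jint q p) ler_norml => /andP[_ h1].
have := tint_density_close dq bq bu He; rewrite -/(jint q q) ler_norml => /andP[h2 _].
have := ler_wpM2l K0 conv; have := ler_wpM2l K0 h1; have := ler_wpM2l K0 h2; lra.
Qed.

(** Arzela-Ascoli with a free ultrafilter in place of a diagonal subsequence: the pointwise limit
    exists at once, and a finite grid makes the approximation uniform for arbitrarily large [n]. *)
Lemma equilipschitz_limit (v : nat -> R -> R) (L : R) :
  (forall n x, 0 <= v n x <= 1) ->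
  (forall n s t, `|v n s - v n t| <= L * `|s - t|) ->
  exists u : R -> R, (forall s t, `|u s - u t| <= L * `|s - t|) /\
    forall e n0, 0 < e -> exists2 n, (n0 <= n)%N &
      forall x, Tor x -> `|v n x - u x| <= e.
Proof.
move=> v01 vL.
have [F [FU Foo]] := ultraFilterLemma (@eventually_filter).
have PF : ProperFilter F by exact: ultra_proper.
have lim x : exists l, forall e, 0 < e -> F [set n | `|v n x - l| < e].
  have Fv : (v ^~ x @ F) `[0, 1]%classic.
    by apply: (@filterE _ F) => n /=; rewrite in_itv /=; exact: v01.
  have [l [_ Fl]] := @segment_compact R 0 1 _ _ Fv.
  exists l => e e0; have [//|nF] := in_ultra_setVsetC [set n | `|v n x - l| < e] FU.
  have nFv : (v ^~ x @ F) [set y | ~ (`|y - l| < e)] by exact: nF.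
  have [y [/= ye]] := Fl _ _ nFv (nbhsx_ballx l e e0).
  by rewrite /ball /= distrC.
have {lim} [u Hu] := boolp.choice lim.
have meet A B : F A -> F B -> exists n, A n /\ B n.
  move=> FA FB; have FAB : F (A `&` B) by exact: filterI.
  exact: filter_ex FAB.
have uL s t : `|u s - u t| <= L * `|s - t|.
  apply/ler_addgt0Pr => e e0; have e2 : 0 < e / 2 by rewrite divr_gt0.
  have [n /= [h1 h2]] := meet _ _ (Hu s _ e2) (Hu t _ e2).
  have := vL n s t; move: h1 h2; rewrite !ltr_norml !ler_norml.
  by move=> /andP[? ?] /andP[? ?] /andP[? ?]; apply/andP; split; lra.
exists u; split=> // e n0 e0.
have L0 : 0 <= L by have := le_trans (normr_ge0 _) (vL 0%N 0 1);
  rewrite sub0r normrN normr1 mulr1.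
(* The mesh satisfies [L / M < e / 4]: moving to a grid point costs [e / 4] for [v n] and for [u],
   and the grid itself accounts for [e / 2]. *)
pose M := (Num.truncn (4 * L / e)).+1.
have M0 : 0 < M%:R :> R by rewrite ltr0n.
have hM : 4 * L < M%:R * e.
  by rewrite -ltr_pdivrMr// real_truncnS_gt// num_real.
pose grid j : R := - 2^-1 + j%:R / M%:R.
have e2 : 0 < e / 2 by rewrite divr_gt0.
have Hgrid m : F [set n | forall j, (j < m)%N -> `|v n (grid j) - u (grid j)| < e / 2].
  elim: m => [|m IH]; first by apply: (@filterE _ F) => n j.
  have FIH : F ([set n | forall j, (j < m)%N -> `|v n (grid j) - u (grid j)| < e / 2]
      `&` [set n | `|v n (grid m) - u (grid m)| < e / 2]) by apply: filterI => //; exact: Hu.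
  apply: filterS FIH => n /= [h1 h2] j.
  by rewrite ltnS leq_eqVlt => /predU1P[->//|]; exact: h1.
have [n /= [h1 h2]] := meet _ _ (Hgrid M) (Foo _ (nbhs_infty_ge n0)).
exists n => // x; rewrite /Defs.Tor /= in_itv /= => /andP[x1 x2].
pose j := Num.truncn ((x + 2^-1) * M%:R).
have y0 : 0 <= (x + 2^-1) * M%:R by rewrite mulr_ge0 ?(ltW M0)//; lra.
have /andP[j1 j2] := truncn_itv y0.
have jM : (j < M)%N.
  rewrite -(ltr_nat R) (le_lt_trans j1)// gtr_pMl//; lra.
have near : `|x - grid j| <= M%:R^-1.
  have xE : x = - 2^-1 + ((x + 2^-1) * M%:R) / M%:R by rewrite mulfK ?gt_eqF//; lra.
  rewrite /grid [in leLHS]xE opprD addrACA subrr add0r -mulrBl.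
  rewrite normrM ger0_norm ?subr_ge0// ger0_norm ?invr_ge0 ?(ltW M0)//.
  rewrite ler_piMl ?invr_ge0 ?(ltW M0)//.
  by move: j2; rewrite -natr1 -/j; lra.
have hL : L * `|x - grid j| <= e / 4.
  rewrite (le_trans (ler_wpM2l L0 near))// ler_pdivrMr//; lra.
have := h1 j jM; have := vL n x (grid j); have := uL x (grid j).
move: hL; move: (L * _) => LL; rewrite ltr_norml !ler_norml.
by move=> ? /andP[? ?] /andP[? ?] /andP[? ?]; apply/andP; split; lra.
Qed.

(** The minimizer is the Gibbs state of the limit [u] of the potentials of a minimizing sequence.
    Its energy exceeds that of [qn n] by at most [4 K d], with [d] as small and [n] as large as
    desired. *)
Lemma minimizer_exists (K : R) : 0 <= K ->
  exists p, is_global_minimizer (@W_DO R) K p.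
Proof.
move=> K0.
pose E := [set (ent q + K * jint q q) | q in [set q | is_density q /\ has_entropy q]].
have du := density_q_u R; have [eu iu] := ent_u R.
have Eu : E (ent (@q_u R) + K * jint (@q_u R) (@q_u R)) by exists (@q_u R).
have Elb : has_lbound E.
  exists 0 => _ [q [dq eq] <-]; rewrite addr_ge0 ?ent_ge0// mulr_ge0//.
  exact: jint_ge0.
have Einf : has_inf E by split => //; eexists; exact: Eu.
have adh n : exists q, [/\ is_density q, has_entropy q &
    ent q + K * jint q q < inf E + n.+1%:R^-1].
  have n0 : 0 < n.+1%:R^-1 :> R by rewrite invr_gt0.
  have [_ [q [dq eq] <-] h] := inf_adherent n0 Einf.
  by exists q.
have [qn Hqn] := boolp.choice adh.
have dn n : is_density (qn n) by have [] := Hqn n.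
have [u [uL Hu]] := @equilipschitz_limit (fun n => potential (qn n)) (2 * pi)
  (fun n x => introT andP (conj (potential_ge0 x (dn n)) (potential_le1 x (dn n))))
  (fun n s t => potential_lipschitz s t (dn n)).
have bu : tbounded u by apply/tbounded_continuous/lipschitz_continuous; exact: uL.
have [p [dp ep Hp]] := gibbs_state K bu.
have pE : ent p + K * jint p p <= inf E.
  apply/ler_addgt0Pr => e e0.
  pose d := e / (2 * (4 * K + 1)).
  have d0 : 0 < d by rewrite divr_gt0// mulr_gt0// ltr_wpDl// mulr_ge0.
  have [n nn Hn] := Hu d (Num.truncn (2 / e)) d0.
  have [_ en hn] := Hqn n.
  have := gibbs_state_energy K0 bu dp (dn n) (Hp _ (dn n) en) Hn.
  have n1 : n.+1%:R^-1 <= e / 2.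
    rewrite -[leRHS]invrK lef_pV2 ?posrE ?invr_gt0 ?divr_gt0// invf_div.
    rewrite (le_trans (ltW (real_truncnS_gt (num_real (2 / e)))))// ler_nat ltnS//.
  have d2 : 4 * K * d <= e / 2.
    have -> : e / 2 = (4 * K + 1) * d.
      by rewrite /d; field; rewrite gt_eqF// ltr_wpDl// mulr_ge0.
    by rewrite ler_pM2r// lerDl.
  move: hn n1 d2; move: (inf E) (n.+1%:R^-1) (4 * K * d) => i m c.
  move: (ent p + _) (ent (qn n) + _) => x y; lra.
exists p; split => // r dr.
have [er|er] := entropy_dichotomy dr; last by rewrite [leRHS]free_energy_infty// leey.
rewrite !free_energyE// lee_fin (le_trans pE)//; apply: ge_inf => //.
by exists r.
Qed.

Lemma tint_ae (f h : R -> R) : measurable_fun Tor f -> measurable_fun Tor h ->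
  {ae mu, forall x, Tor x -> f x = h x} -> tint f = tint h.
Proof.
move=> mf mh fh; rewrite /tint /Rintegral; congr fine.
apply: ae_eq_integral.
- exact: measurable_Tor.
- exact/measurable_EFinP.
- exact/measurable_EFinP.
- by move: fh; apply: filterS; first exact: (ae_filter_ringOfSetsType mu);
    move=> x H Tx; rewrite H.
Qed.

Lemma dens_eq_jint q : is_density q -> dens_eq q (@q_u R) ->
  jint q q = 2 / pi.
Proof.
move=> dq qu; have iq := density_integrable dq.
have du := density_q_u R.
rewrite -jint_u; transitivity (jint (@q_u R) q).
  rewrite /jint; apply: eq_tint => x _; congr (_ * _).
  apply: tint_ae.
  - by apply: tintegrable_measurable; exact: potential_integrable.
  - by apply: tintegrable_measurable; exact: potential_integrable.
  - by move: qu; apply: filterS; first exact: (ae_filter_ringOfSetsType mu);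
      move=> y H Ty; rewrite H.
apply: tint_ae.
- by apply: tintegrable_measurable; exact: potential_density_integrable.
- by apply: tintegrable_measurable; exact: potential_density_integrable.
- by move: qu; apply: filterS; first exact: (ae_filter_ringOfSetsType mu);
    move=> y H Ty; rewrite H.
Qed.

(** * Instability above the critical coupling *)

Lemma ln1D_le (u : R) : - 2^-1 <= u <= 2^-1 ->
  ln (1 + u) <= u - u ^+ 2 / 2 + u ^+ 3 / 3.
Proof.
move=> /andP[ul ur].
pose f (t : R) : R := t - t ^+ 2 / 2 + t ^+ 3 / 3 - ln (1 + t).
(* The derivative of the difference has the sign of [t], so the difference is smallest at [0]. *)
pose df (t : R) : R := t ^+ 3 / (1 + t).
have dF (t : R) : - 2^-1 <= t -> is_derive t 1 f (df t).
  move=> t1; have t0 : 0 < 1 + t by lra.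
  have dln := is_derive_compf (is_derive1_ln t0)
    (is_derive_addf (is_derive_constf 1 t) (is_derive_idf t)).
  rewrite (_ : f = fun t => t - t * t * 2^-1 + t * t * t * 3^-1 - ln (1 + t)); last first.
    by apply/funext => y; rewrite /f; ring.
  notypeclasses refine (is_derive_eq _ _).
    notypeclasses refine (is_derive_addf _ _); last by apply: is_derive_oppf; exact: dln.
    by repeat deriv_step.
  by rewrite /df; field; rewrite gt_eqF.
have f0 : f 0 = 0 by rewrite /f addr0 ln1 !expr0n /= !mul0r !subr0 addr0.
suff : 0 <= f u by rewrite /f; lra.
have [u0|u0|->] := ltgtP u 0; last by rewrite f0.
- have [c|c /andP[c1 c2]] := @mvt_deriv R f df u 0 u0.
    by rewrite in_itv /= => /andP[c1 _]; apply: dF; lra.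
  rewrite f0 !sub0r => E; have : df c <= 0.
    rewrite /df mulr_le0_ge0//; last by rewrite invr_ge0; lra.
    by rewrite exprS mulr_le0_ge0 ?sqr_ge0// ltW.
  nra.
- have [c|c /andP[c1 c2]] := @mvt_deriv R f df 0 u u0.
    by rewrite in_itv /= => /andP[c1 _]; apply: dF; lra.
  rewrite f0 !subr0 => ->; rewrite mulr_ge0 ?(ltW u0)// divr_ge0//.
    by rewrite exprn_ge0// ltW.
  lra.
Qed.

Lemma tint_cos1 : tint (fun x : R => cos (phase x)) = 0.
Proof.
transitivity (((1 == 0)%N%:R) : R) => //; rewrite -(@tint_cos R 1 0).
by apply: eq_tint => x _; rewrite subr0 mul1r.
Qed.

Lemma tint_cos1_sqr : tint (fun x : R => cos (phase x) ^+ 2) = 2^-1.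
Proof.
have i2 : tintegrable (fun x : R => cos ((2%:R - 0%:R) * phase x)).
  exact/tintegrable_tbounded/tbounded_cos.
rewrite (@eq_tint _ _ (fun x => 2^-1 + 2^-1 * cos ((2%:R - 0%:R) * phase x))).
  rewrite tintD ?tintZl ?tint_cst ?(@tint_cos R 2 0) ?mulr0 ?addr0//.
    exact/tintegrable_tbounded/tbounded_cst.
  exact: tintegrableZl.
move=> x _; have := cos2Dsin2 (phase x).
have -> : (2%:R - 0%:R) * phase x = phase x + phase x by ring.
rewrite cosD -!expr2; lra.
Qed.

Lemma unstable (K : R) : 3 * pi / 4 < K ->
  exists q, [/\ is_density q, has_entropy q &
    ent q + K * jint q q < K * (2 / pi)].
Proof.
move=> hK; have Kc0 := Kc_gt0 R.
have r1 : 1 < K / (3 * pi / 4) by rewrite ltr_pdivlMr ?mul1r.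
set r := K / (3 * pi / 4) in r1.
(* The bound [1 / 2] keeps the density positive and [ln1D_le] applicable; [(r - 1) / 2] makes the
   cubic term [e^3 / 3] smaller than the gain [(r - 1) e^2 / 4]. *)
pose e := Num.min (2^-1) ((r - 1) / 2).
have e0 : 0 < e by rewrite lt_min invr_gt0 ltr0n divr_gt0// subr_gt0.
have e1 : e <= 2^-1 by rewrite ge_min lexx.
have e2 : e <= (r - 1) / 2 by rewrite ge_min lexx orbT.
pose u x : R := e * cos (phase x).
have bc : tbounded (fun x : R => cos (phase x)).
  rewrite (_ : (fun x => _) = fun x => cos (1 * phase x)); first exact: tbounded_cos.
  by apply/funext => x; rewrite mul1r.
have bu : tbounded u by apply: tboundedM => //; exact: tbounded_cst.
pose q x := 1 + u x.
have bq : tbounded q by apply: tboundedD => //; exact: tbounded_cst.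
have ule x : - e <= u x <= e.
  by rewrite -ler_norml normrM ger0_norm ?(ltW e0)// ler_piMr ?(ltW e0)// cos_max.
have i1 (c : R) : tintegrable (fun=> c) by exact/tintegrable_tbounded/tbounded_cst.
have iu := tintegrable_tbounded bu; have ic := tintegrable_tbounded bc.
have tu : tint u = 0 by rewrite /u tintZl// tint_cos1 mulr0.
have bc2 : tbounded (fun x : R => cos (phase x) ^+ 2) by exact: tboundedM.
have ic2 := tintegrable_tbounded bc2.
have dq : is_density q.
  apply: is_densityP; [by case: bq| |exact: tintegrable_tbounded|].
    by move=> x _; rewrite /q; have := ule x; lra.
  by rewrite tintD// tu tint_cst addr0.
have eq : has_entropy q.
  apply/tintegrable_tbounded/tboundedM => //; split.
    by apply: measurableT_comp; [exact: measurable_ln|case: bq].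
  exists (ln 2) => x _; have ux := ule x.
  have q1 : 2^-1 <= q x by rewrite /q; lra.
  have q2 : q x <= 2 by rewrite /q; lra.
  have q0 : 0 < q x by lra.
  by rewrite ler_norml -lnV ?posrE// !ler_ln ?posrE ?invr_gt0 ?q1 ?q2//.
exists q; split => //.
have hent : ent q <= e ^+ 2 / 4 + e ^+ 3 / 3.
  apply: (@le_trans _ _ (tint (fun x => u x + ((e ^+ 2 / 2) * cos (phase x) ^+ 2 + e ^+ 3 / 3)))).
    apply: le_tint => //.
      by apply: tintegrableD => //; apply: tintegrableD => //; exact: tintegrableZl.
    move=> x _; have ux := ule x.
    have := @ln1D_le (u x); rewrite -/(q x).
    have q0 : 0 <= q x by rewrite /q; lra.
    move=> /(_ _)h; have {}h := h _; have {h} : ln (q x) <= u x - u x ^+ 2 / 2 + u x ^+ 3 / 3 by apply: h; lra.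
    move=> /(ler_wpM2l q0)/le_trans; apply.
    rewrite (_ : e ^+ 2 / 2 * cos (phase x) ^+ 2 = u x ^+ 2 / 2); last by rewrite /u; ring.
    have [e3 e3'] : u x ^+ 3 <= e ^+ 3 /\ - e ^+ 3 <= u x ^+ 3.
      apply/andP; rewrite andbC -ler_norml normrX lerXn2r ?nnegrE ?(ltW e0)//.
      by rewrite ler_norml.
    (* The product [(1 + u) (u - u^2 / 2 + u^3 / 3)] is [u + u^2 / 2 - u^3 / 6 + u^4 / 3], and for
       [|u| <= 1 / 2] its last two terms are at most [|u|^3 / 3]. *)
    rewrite /q; nra.
  rewrite tintD ?tu ?add0r; [|exact: iu|by apply: tintegrableD => //; exact: tintegrableZl].
  rewrite tintD ?tintZl ?tint_cst ?tint_cos1_sqr//; last exact: tintegrableZl.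
  lra.
have hgap : e ^+ 2 / 4 <= gap q.
  have := mode_energy2_le dq; have := mode_energy_ge0 q 2.
  have : e ^+ 2 / 4 <= mode_energy q 1.
    rewrite /mode_energy (_ : mode_cos q 1 = e / 2).
      by have := sqr_ge0 (mode_sin q 1); lra.
    rewrite /mode_cos (@eq_tint _ _ (fun x => cos (phase x) + e * cos (phase x) ^+ 2)).
      by rewrite tintD ?tintZl ?tint_cos1 ?tint_cos1_sqr ?add0r//; exact: tintegrableZl.
    by move=> x _; rewrite /q /u mul1r; ring.
  lra.
have : K * (2 / pi - jint q q) = r * gap q by rewrite gapE.
rewrite mulrBr => E.
suff : ent q < r * gap q by lra.
apply: (le_lt_trans hent); apply: (@lt_le_trans _ _ (r * (e ^+ 2 / 4))).
  have e20 : 0 < e ^+ 2 by rewrite exprn_gt0.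
  have : e ^+ 3 <= e ^+ 2 * ((r - 1) / 2) by rewrite exprSr ler_pM2l.
  nra.
by rewrite ler_pM2l//; lra.
Qed.

End existence.

(** * The phase transition *)

Section transition.
Variable R : realType.
Local Notation Tor := (@Defs.Tor R).
Implicit Types (q : R -> R).

Lemma nontrivial_minimizer (K : R) : 3 * pi / 4 < K ->
  exists q, is_global_minimizer (@W_DO R) K q /\ ~ dens_eq q (@q_u R).
Proof.
move=> hK; have K0 : 0 <= K by rewrite ltW// (lt_trans (Kc_gt0 R)).
have [p Hp] := minimizer_exists K0; exists p; split => // pu.
have [dp ep _] := minimizer_entropy Hp.
have [r [dr er hr]] := unstable hK.
have := Hp.2 r dr; rewrite !free_energyE// lee_fin dens_eq_jint//.
have := ent_ge0 dp ep; lra.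
Qed.

(** For a minimizer the deficit [ent q - gap q] is at most [K - Kc], because [2 / pi - jint q q]
    lies in [[0, 1]]. The a priori bound [ent q <= Kc + 1] makes the constant of the quartic
    estimate uniform. *)
Lemma minimizer_ent_small (k : R) : 0 < k -> exists2 d, 0 < d &
  forall K q, 3 * pi / 4 < K < 3 * pi / 4 + d ->
    is_global_minimizer (@W_DO R) K q -> ent q <= k.
Proof.
move=> k0; have Kc0 := Kc_gt0 R.
set Kc : R := 3 * pi / 4 in Kc0 *.
pose B : R := 20 / 3 + 8 * expR (Kc + 1).
have B0 : 0 < B by rewrite addr_gt0// mulr_gt0// expR_gt0.
(* [d <= 1] yields the entropy bound behind [B]; the last entry gives [mode_energy q 1 <= k / 2];
   and [ent q <= mode_energy q 1 + 5 d / 3], where [3 k / 10] makes the second term at most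
   [k / 2]. *)
pose d := Num.min 1 (Num.min (3 * k / 10) (k ^+ 2 / 4 / B)).
have d0 : 0 < d by rewrite !lt_min ltr01 !divr_gt0 ?mulr_gt0 ?exprn_gt0.
have d1 : d <= 1 by rewrite ge_min lexx.
have d2 : d <= 3 * k / 10 by rewrite !ge_min lexx orbT.
have d3 : d <= k ^+ 2 / 4 / B by rewrite !ge_min lexx !orbT.
exists d => // K q /andP[KK Kd] /minimizer_entropy[dq eq h].
have [y0 ge c1] := gap_le_ent dq eq.
have Dle1 : 2 / pi - jint q q <= 1.
  have := jint_ge0 dq dq; have : 2 / pi <= 1 :> R.
    by rewrite ler_pdivrMr ?pi_gt0// mul1r pi_ge2.
  lra.
have gapD : gap q = Kc * (2 / pi - jint q q) by [].
have D0 : 0 <= 2 / pi - jint q q.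
  by rewrite -(pmulr_rge0 _ Kc0) -gapD gap_ge0.
set D := 2 / pi - jint q q in h gapD Dle1 D0.
have KD : K * D = gap q + (K - Kc) * D by rewrite gapD; ring.
have tD : (K - Kc) * D <= K - Kc by rewrite ler_piMr//; lra.
have def : ent q - gap q <= d by lra.
have KcD : Kc * D <= Kc by rewrite ler_piMr// ltW.
have entE : ent q <= Kc + 1 by lra.
have c1' : mode_energy q 1 ^+ 2 <= (k / 2) ^+ 2.
  rewrite (le_trans c1)// (_ : (k / 2) ^+ 2 = B * (k ^+ 2 / 4 / B)); last first.
    by field; rewrite gt_eqF.
  apply: ler_pM; [|lra| |lra].
  - by rewrite addr_ge0// mulr_ge0// expR_ge0.
  - by rewrite lerD2l ler_pM2l// ler_expR.
have c2 : mode_energy q 1 <= k / 2.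
  by move: c1'; rewrite ler_pXn2r// nnegrE ?mode_energy_ge0// divr_ge0// ltW.
have := entropy_deficit dq eq.
have : 0 <= mode_defect q * expR (- ent q).
  by rewrite mulr_ge0 ?expR_ge0 ?mode_defect_ge0.
lra.
Qed.

Lemma L1_dist_uE q : is_density q -> L1_dist_u q = (tint (fun x => `|q x - 1|))%:E.
Proof.
move=> dq; have iq := density_integrable dq.
rewrite /L1_dist_u tintE//; apply: tintegrable_norm; apply: tintegrableB => //.
exact/tintegrable_tbounded/tbounded_cst.
Qed.

Lemma minimizers_converge (qK : R -> R -> R) :
  (forall K, 3 * pi / 4 < K -> is_global_minimizer (@W_DO R) K (qK K)) ->
  (fun K => L1_dist_u (qK K)) @ (3 * pi / 4)^'+ --> 0%E.
Proof.
move=> Hq; set Kc : R := 3 * pi / 4.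
apply: cvg_EFin.
  near=> K; rewrite L1_dist_uE//.
  have KcK : Kc < K by near: K; exact: nbhs_right_gt.
  by have [] := Hq K KcK.
apply/cvgrPdist_lt => e e0.
pose eta := Num.min 2^-1 (e / 6).
have eta0 : 0 < eta by rewrite lt_min invr_gt0 ltr0n divr_gt0.
have eta1 : eta <= 2^-1 by rewrite ge_min lexx.
have eta2 : eta <= e / 6 by rewrite ge_min lexx orbT.
(* With [ent <= eta^2] the distance is at most [2 eta + eta], hence at most [e / 2]. *)
have [d d0 Hd] := minimizer_ent_small (mulr_gt0 eta0 eta0).
near=> K.
have KcK : Kc < K by near: K; exact: nbhs_right_gt.
have KKd : K < Kc + d by near: K; apply: nbhs_right_lt; rewrite ltrDl.
have Hm := Hq K KcK; have [dq eq _] := minimizer_entropy Hm.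
rewrite /= L1_dist_uE//= sub0r normrN ger0_norm; last by apply: tint_ge0 => x _.
have := @entropy_L1 _ _ eta dq eq; rewrite eta0 eta1 => /(_ isT) h.
have : ent (qK K) / eta <= eta.
  by rewrite ler_pdivrMr// (Hd K)// KcK.
lra.
Unshelve. all: by end_near.
Qed.

(** * Fourier coefficients of the kernel and the linear stability threshold *)

Lemma tbounded_kern0 : tbounded (@kern R).
Proof.
rewrite (_ : @kern R = fun y => kern (0 - y)); first exact: tbounded_kern.
by apply/funext => y; rewrite /kern sub0r mulrN sinN normrN.
Qed.

(** [kern_expansion] at [y = 0], integrated against [h]; a cosine or a sine for [h] yields the real
    or imaginary Fourier coefficient. *)
Lemma kern_test_close (h : R -> R) N : tbounded h -> (forall x, `|h x| <= 1) ->
  `|tint (fun x => kern x * h x) - (2 / pi * tint h - 4 / pi *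
     \sum_(i < N) sine_weight R i * tint (fun x => cos (i.+1%:R * phase x) * h x))|
  <= kern_tol R N.
Proof.
move=> bh h1; have ih := tintegrable_tbounded bh.
have bk := tbounded_kern0.
have bch i : tbounded (fun x => cos (i%:R * phase x) * h x).
  by apply: tboundedM => //; exact: tbounded_cos.
have ich i := tintegrable_tbounded (bch i).
pose s x := 2 / pi * h x - 4 / pi *
  \sum_(i < N) sine_weight R i * (cos (i.+1%:R * phase x) * h x).
have isum : tintegrable (fun x =>
    \sum_(i < N) sine_weight R i * (cos (i.+1%:R * phase x) * h x)).
  by apply: tintegrable_sum => i; exact: tintegrableZl.
have ikh : tintegrable (fun x => kern x * h x).
  exact/tintegrable_tbounded/tboundedM.
have is_ : tintegrable s by apply: tintegrableB; exact: tintegrableZl.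
have <- : tint s = 2 / pi * tint h - 4 / pi *
     \sum_(i < N) sine_weight R i * tint (fun x => cos (i.+1%:R * phase x) * h x).
  rewrite /s tintB; [|exact: tintegrableZl|exact: tintegrableZl].
  rewrite (tintZl _ ih) (tintZl _ isum); congr (_ - _ * _).
  rewrite tint_sum; last by move=> i; exact: tintegrableZl.
  by apply: eq_bigr => i _; rewrite tintZl.
rewrite -tintB// (le_trans (tint_norm _))//; first exact: tintegrableB.
rewrite -[leRHS]tint_cst; apply: le_tint.
- by apply: tintegrable_norm; exact: tintegrableB.
- exact/tintegrable_tbounded/tbounded_cst.
move=> x Tx; have T0 : Tor 0 by rewrite /Defs.Tor /= in_itv /=; lra.
have := kern_expansion N Tx T0; rewrite subr0.
have -> : kern x * h x - s x = (kern x - kern_sum N x 0) * h x.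
  rewrite mulrBl; congr (_ - _); rewrite /s /kern_sum mulrBl.
  rewrite -[4 / pi * _ * h x]mulrA [in RHS]mulr_suml; congr (_ - _ * _); apply: eq_bigr => i _.
  by rewrite /phase mulr0 mulr0 cos0 sin0; ring.
by move=> hk; rewrite normrM (le_trans _ hk)// ler_piMr.
Qed.

Lemma fourier_reE k N : (0 < k)%N ->
  `|fourier_re (@W_DO R) k - 2 / pi * \sum_(i < N) sine_weight R i * (i.+1 * 2 == k)%N%:R|
  <= kern_tol R N.
Proof.
move=> k0; pose h x : R := cos (k%:R * half_phase x).
have bh : tbounded h by exact: tbounded_cos_half.
have ck : tbounded (fun x => kern x * h x).
  by apply: tboundedM => //; exact: tbounded_kern0.
have := @kern_test_close h N bh (fun x => cos_max _).
have -> : tint h = 0.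
  transitivity (((k == 0)%N%:R) : R); last by rewrite gtn_eqF.
  by rewrite -tint_cos_half; apply: eq_tint => x _; rewrite subr0.
have tc i : tint (fun x => cos (i.+1%:R * phase x) * h x) = 2^-1 * (i.+1 * 2 == k)%N%:R.
  rewrite (@eq_tint _ _ (fun x =>
    2^-1 * (cos (((i.+1 * 2)%N%:R - k%:R) * half_phase x) +
            cos (((i.+1 * 2 + k)%N%:R - 0%:R) * half_phase x)))).
    rewrite tintZl; last by apply: tintegrableD; apply: tintegrable_tbounded;
      exact: tbounded_cos_half.
    rewrite tintD; [|apply: tintegrable_tbounded; exact: tbounded_cos_half..].
    by rewrite !tint_cos_half addn_eq0 (gtn_eqF k0) andbF addr0.
  by move=> x _; rewrite subr0 phase_half natrD natrM mulrBl mulrDl cosB cosD /h; field.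
have -> : tint (fun x => kern x * h x) = - fourier_re (@W_DO R) k.
  rewrite /fourier_re -/(tint _) -mulN1r -tintZl.
    apply: eq_tint => x _; rewrite /W_DO /kern /h /half_phase.
    by rewrite (_ : 2 * pi * k%:R * x = k%:R * (2 * pi * x)); ring.
  rewrite (_ : (fun x => _) = fun x => (-1) * (kern x * h x)).
    exact/tintegrableZl/tintegrable_tbounded.
  apply/funext => x; rewrite /W_DO /kern /h /half_phase.
  by rewrite (_ : 2 * pi * k%:R * x = k%:R * (2 * pi * x)); ring.
rewrite mulr0 sub0r opprK.
have -> : 4 / pi * \sum_(i < N) sine_weight R i *
    tint (fun x => cos (i.+1%:R * phase x) * h x) =
  2 / pi * \sum_(i < N) sine_weight R i * (i.+1 * 2 == k)%N%:R.
  rewrite !mulr_sumr; apply: eq_bigr => i _.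
  by rewrite tc; move: (pi^-1 : R) => p; field.
by rewrite addrC -normrN opprB.
Qed.

Lemma sine_weight_le i : sine_weight R i <= 3^-1.
Proof.
rewrite /sine_weight lef_pV2 ?posrE//; last first.
  by rewrite -invr_gt0; exact: sine_weight_gt0.
have h : 1 <= i.+1%:R :> R by rewrite ler1n.
nra.
Qed.

(** At most one [i] satisfies [2 (i + 1) = k], and none does for odd [k]; the weights decrease from
    [1 / 3]. *)
Lemma weight_sum_le k N :
  \sum_(i < N) sine_weight R i * (i.+1 * 2 == k)%N%:R <= 3^-1.
Proof.
case: (pickP (fun i : 'I_N => (i.+1 * 2 == k)%N)) => [j /eqP jk|none].
  rewrite (bigD1 j)//= jk eqxx mulr1 big1 ?addr0 ?sine_weight_le// => i ij.
  rewrite (_ : (_ == k)%N = false) ?mulr0//; apply: contraNF ij.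
  by rewrite -jk eqn_pmul2r// eqSS => /eqP ij; apply/eqP/val_inj.
by rewrite big1 ?invr_ge0// => i _; rewrite none mulr0.
Qed.

Lemma fourier_re_le k : (0 < k)%N -> fourier_re (@W_DO R) k <= 2 / pi / 3.
Proof.
move=> k0; apply: (@kern_tol_lim R _ _ 1) => // N _.
have := fourier_reE N k0; have := weight_sum_le k N.
have p0 : 0 <= 2 / pi :> R by rewrite divr_ge0// pi_ge0.
move=> /(ler_wpM2l p0); set s := _ * \sum_(i < N) _.
by rewrite ler_norml mul1r => hs /andP[_]; lra.
Qed.

Lemma fourier_re2 : fourier_re (@W_DO R) 2 = 2 / pi / 3.
Proof.
apply/eqP; rewrite eq_le fourier_re_le//=.
apply: (@kern_tol_lim R _ _ 1) => // -[//|N] _.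
have := @fourier_reE 2 N.+1 isT.
rewrite big_ord_recl /= mulr1 big1 => [|i _]; last by rewrite mulr0.
have -> : sine_weight R 0 = 3^-1 by rewrite /sine_weight; congr (_^-1); ring.
by rewrite addr0 mul1r ler_norml => /andP[h _]; lra.
Qed.

Lemma fourier_im2 : fourier_im (@W_DO R) 2 = 0.
Proof.
pose h x : R := sin (1 * phase x).
have bh : tbounded h by exact: tbounded_sin.
have th : tint h = 0.
  by rewrite -(@tint_sin R 1 0); apply: eq_tint => x _; rewrite subr0.
have tc i : tint (fun x => cos (i.+1%:R * phase x) * h x) = 0.
  rewrite (@eq_tint _ _ (fun x =>
    2^-1 * (sin ((i.+2%:R - 0%:R) * phase x) + sin ((1%:R - i.+1%:R) * phase x)))).
    rewrite tintZl; last by apply: tintegrableD; apply: tintegrable_tbounded;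
      exact: tbounded_sin.
    rewrite tintD; [|apply: tintegrable_tbounded; exact: tbounded_sin..].
    by rewrite !tint_sin addr0 mulr0.
  by move=> x _; rewrite subr0 -[i.+2%:R]natr1 mulrBl mulrDl sinB sinD /h !mul1r; field.
have E : fourier_im (@W_DO R) 2 = tint (fun x => kern x * h x).
  have ck : tbounded (fun x => kern x * h x).
    by apply: tboundedM => //; exact: tbounded_kern0.
  rewrite /fourier_im -/(tint _) -[RHS]opprK; congr (- _).
  rewrite -mulN1r -tintZl; last exact: tintegrable_tbounded.
  apply: eq_tint => x _; rewrite /W_DO /kern /h /phase.
  by rewrite (_ : 2 * pi * 2%:R * x = 1 * (4 * pi * x)); ring.
have H N := @kern_test_close h N bh (fun x => sin_max _).
have {}H N : `|tint (fun x => kern x * h x)| <= kern_tol R N.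
  have := H N; rewrite th big1; last by move=> i _; rewrite tc mulr0.
  by rewrite !mulr0 !subr0.
rewrite E; apply/eqP; rewrite eq_le; apply/andP; split;
  apply: (@kern_tol_lim R _ _ 1) => // N _; have := H N;
  by rewrite mul1r ler_norml => /andP[]; lra.
Qed.

(** The largest coefficient is [2 / (3 pi)], at frequency [2], which is the mode [l = 1]. *)
Lemma linear_threshold : is_linear_threshold (@W_DO R) (3 * pi / 4).
Proof.
have p0 := pi_gt0 R; exists 2%N; split => //; split.
  by split; [exact: fourier_im2|rewrite fourier_re2 !divr_gt0].
split; first by move=> k k1 _; rewrite fourier_re2; exact: fourier_re_le.
rewrite fourier_re2; have : pi != 0 :> R by rewrite gt_eqF.
by move: (pi : R) => p pn0; field.
Qed.

End transition.

Theorem theorem1p8 (R : realType) :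
  is_critical_coupling (@W_DO R) (3 * pi / 4) /\
  is_linear_threshold (@W_DO R) (3 * pi / 4) /\
  continuous_transition (@W_DO R) (3 * pi / 4).
Proof.
have Kc0 := ltW (Kc_gt0 R).
split; [|split; first exact: linear_threshold].
  split => //; split.
    move=> K K0 KK; have hK : 0 <= K <= 3 * pi / 4 by rewrite K0 ltW.
    by split; [exact: minimizer_u|move=> q; exact: minimizer_unique hK].
  split; first by apply: minimizer_u; rewrite Kc0 lexx.
  exact: nontrivial_minimizer.
split; last exact: minimizers_converge.
have hK : 0 <= (3 * pi / 4 : R) <= 3 * pi / 4 by rewrite Kc0 lexx.
move=> q1 q2 /(minimizer_unique hK) h1 /(minimizer_unique hK) h2.
move: h1 h2; rewrite /dens_eq; apply: filterS2; first exact: (ae_filter_ringOfSetsType (@lebesgue_measure R)).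
by move=> x h1 h2 Tx; rewrite h1// h2.
Qed.
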